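(* Let $0<q<1$. The following irreducible admissible type I unitary representations of $U_q(\mathfrak{su}(1,1))$ are obtained from the modules $M(\mathbb C_{\lambda,\mu})$. (a) Let $(\sigma,\varepsilon)$ be one of: (i) (principal series) $\sigma=-\tfrac12+ib$ with $0\le b\le -\frac{\pi}{2\ln q}$, $\varepsilon\in\{0,\tfrac12\}$, $(\sigma,\varepsilon)\ne(-\tfrac12,\tfrac12)$; (ii) (strange series) $\sigma=-\tfrac12-\frac{i\pi}{2\ln q}+a$ with $a>0$, $\varepsilon\in\{0,\tfrac12\}$; (iii) (complementary series) $-\tfrac12<\sigma<0$, $\varepsilon=0$. For any $\lambda\in q^{2\varepsilon+2\mathbb Z}$ let $\mu$ be determined by $$\mu+\frac{q^{-1}\lambda+q\lambda^{-1}}{(q-q^{-1})^2}=\frac{q^{2\sigma+1}+q^{-2\sigma-1}}{(q^{-1}-q)^2}.$$ Then $M(\mathbb C_{\lambda,\mu})$ is irreducible and unitarizable, and it is equivalent to the representation of the corresponding series with parameters $(\sigma,\varepsilon)$; in particular all such choices of $(\lambda,\mu)$ for given $(\sigma,\varepsilon)$ give equivalent modules. (b) For $k\in\frac12\mathbb N$, the positive discrete series representation with parameter $\sigma=-k$ is equivalent to the quotient of $M(\mathbb C_{\lambda,\mu})$, with $\lambda=q^{2k}$ and $\mu=0$, by the invariant subspace spanned by $F^p\cdot 1$, $p\ge1$. (c) For $k\in\frac12\mathbb N$, the negative discrete series representation with parameter $\sigma=-k$ is equivalent to the quotient of $M(\mathbb C_{\lambda,\mu})$, with $\lambda=q^{-2k}$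 and $\mu=\frac{\lambda-\lambda^{-1}}{q-q^{-1}}$, by the invariant subspace spanned by $E^p\cdot 1$, $p\ge1$.
   Context: $\mathbb N=\{1,2,\dots\}$, $\mathbb N_0=\mathbb N\cup\{0\}$. $U=U_q(\mathfrak{sl}(2,\mathbb C))$ is the unital associative $\mathbb C$-algebra generated by $E,F,K,K^{-1}$ with $KK^{-1}=K^{-1}K=1$, $KE=q^2EK$, $KF=q^{-2}FK$, $EF-FE=\frac{K-K^{-1}}{q-q^{-1}}$. $U_0$ is the centralizer of $K$ in $U$; it is the commutative algebra generated by $EF,K,K^{-1}$. For $\lambda\in\mathbb C\setminus\{0\}$, $\mu\in\mathbb C$, $\mathbb C_{\lambda,\mu}$ is the one-dimensional $U_0$-module on which $K$ acts by $\lambda$ and $EF$ by $\mu$; $M(\mathbb C_{\lambda,\mu})=U\otimes_{U_0}\mathbb C_{\lambda,\mu}$, and $1$ denotes $1\otimes1$ in it. $U_q(\mathfrak{su}(1,1))$ is $U$ with the antilinear anti-multiplicative involution $K^*=K$, $E^*=-FK$, $F^*=-K^{-1}E$. A module is unitarizable if it carries an inner product with $\langle Xv,w\rangle=\langle v,X^*w\rangle$ for all $X\in U$. It is admissible if it is a direct sum of finite-dimensional $K$-eigenspaces, and of type I if the eigenvalues are of the form $q^\tau$, $\tau\in\mathbb R$. The Casimir element is $\Omega=EF+\frac{q^{-1}K+qK^{-1}}{(q-q^{-1})^2}$. The representations in question are irreducible $*$-representations by (unbounded) operators on the space of finite linear combinations of the orthonormal basis vectors $e_k$ of $\ell^2(\mathbb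 Z)$ (principal, strange, complementary series) or $\ell^2(\mathbb N_0)$ (discrete series), and are determined by the action of the Casimir and the eigenvalues of $K$: in all cases $\Omega$ acts as $(q^{2\sigma+1}+q^{-2\sigma-1})/(q^{-1}-q)^2$, and the set of eigenvalues of $K$ (each of multiplicity one) is $q^{2\varepsilon+2\mathbb Z}$ for the principal, strange and complementary series, $q^{2k+2\mathbb N_0}$ for the positive discrete series and $q^{-2k-2\mathbb N_0}$ for the negative discrete series with $\sigma=-k$. Equivalence means isomorphism of $U$-modules (on these domains). *)

(* Defs.v *)
From HB Require Import structures.
From mathcomp Require Import all_boot all_order all_algebra.
From mathcomp Require Import generic_quotient complex.
From mathcomp Require Import all_classical all_reals all_analysis.
From mathcomp Require Import ring.

Set Implicit Arguments.
Unset Strict Implicit.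
Unset Printing Implicit Defensive.

Import Order.TTheory GRing.Theory Num.Theory.

Local Open Scope classical_set_scope.
Local Open Scope ring_scope.
Local Open Scope complex_scope.
Local Open Scope quotient_scope.

(** * Modules over a ring: submodules, quotients, induction *)

Section Modules.
Variable A : pzRingType.

Definition is_submodule (V : lmodType A) (W : set V) : Prop :=
  W 0 /\ forall (a : A) (v w : V), W v -> W w -> W (a *: v + w).

Definition irreducible (V : lmodType A) : Prop :=
  (exists v : V, v != 0) /\
  forall W : set V, is_submodule W -> W = [set 0] \/ W = setT.

Definition isomorphic (V W : lmodType A) : Prop :=
  exists f : {linear V -> W}, bijective f.

End Modules.

Section QuotientModule.
Variables (A : pzRingType) (V : lmodType A) (W : set V) (HW : is_submodule W).

Let W0 : W 0. Proof. by case: HW. Qed.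
Let WP a v w : W v -> W w -> W (a *: v + w).
Proof. by case: HW => _; apply. Qed.
Let WD v w : W v -> W w -> W (v + w).
Proof. by move=> Wv Ww; rewrite -[v]scale1r; apply: WP. Qed.
Let WZ a v : W v -> W (a *: v).
Proof. by move=> Wv; rewrite -[_ *: _]addr0; apply: WP. Qed.
Let WN v : W v -> W (- v).
Proof. by move=> Wv; rewrite -scaleN1r; apply: WZ. Qed.

Definition quotmod_rel (v w : V) : bool := `[< W (v - w) >].

Lemma quotmod_rel_refl : reflexive quotmod_rel.
Proof. by move=> v; apply/asboolP; rewrite subrr. Qed.
Lemma quotmod_rel_sym : symmetric quotmod_rel.
Proof.
by move=> v w; apply/asboolP/asboolP => /WN; rewrite opprB.
Qed.
Lemma quotmod_rel_trans : transitive quotmod_rel.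
Proof.
move=> y x z /asboolP Wxy /asboolP Wyz; apply/asboolP.
by have := WD Wxy Wyz; rewrite addrA subrK.
Qed.

Canonical quotmod_equiv :=
  EquivRel quotmod_rel quotmod_rel_refl quotmod_rel_sym quotmod_rel_trans.

Definition quotmod := {eq_quot quotmod_equiv}.

HB.instance Definition _ := Choice.on quotmod.
HB.instance Definition _ := EqQuotient.on quotmod.

Definition quotmod_pi (v : V) : quotmod := \pi_quotmod v.

Lemma quotmod_piP v w : quotmod_pi v = quotmod_pi w <-> W (v - w).
Proof.
split=> [/eqmodP|H]; first by move=> /asboolP.
by apply/eqmodP/asboolP.
Qed.

Lemma quotmod_ind (P : quotmod -> Prop) :
  (forall v, P (quotmod_pi v)) -> forall x, P x.
Proof. by move=> H x; rewrite -(reprK x); apply: H. Qed.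

Lemma quotmod_repr v : W (repr (quotmod_pi v) - v).
Proof. by apply/quotmod_piP; rewrite /quotmod_pi reprK. Qed.

Definition quotmod_add (x y : quotmod) := quotmod_pi (repr x + repr y).
Definition quotmod_opp (x : quotmod) := quotmod_pi (- repr x).
Definition quotmod_scale (a : A) (x : quotmod) := quotmod_pi (a *: repr x).

Lemma quotmod_addE v w :
  quotmod_add (quotmod_pi v) (quotmod_pi w) = quotmod_pi (v + w).
Proof.
apply/quotmod_piP; rewrite opprD addrACA.
by apply: WD; apply: quotmod_repr.
Qed.
Lemma quotmod_oppE v : quotmod_opp (quotmod_pi v) = quotmod_pi (- v).
Proof. by apply/quotmod_piP; rewrite -opprD; apply/WN/quotmod_repr. Qed.
Lemma quotmod_scaleE a v :
  quotmod_scale a (quotmod_pi v) = quotmod_pi (a *: v).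
Proof. by apply/quotmod_piP; rewrite -scalerBr; apply/WZ/quotmod_repr. Qed.

Fact quotmod_addA : associative quotmod_add.
Proof.
elim/quotmod_ind=> x; elim/quotmod_ind=> y; elim/quotmod_ind=> z.
by rewrite !quotmod_addE addrA.
Qed.
Fact quotmod_addC : commutative quotmod_add.
Proof.
elim/quotmod_ind=> x; elim/quotmod_ind=> y.
by rewrite !quotmod_addE addrC.
Qed.
Fact quotmod_add0 : left_id (quotmod_pi 0) quotmod_add.
Proof. by elim/quotmod_ind=> x; rewrite !quotmod_addE add0r. Qed.
Fact quotmod_addN : left_inverse (quotmod_pi 0) quotmod_opp quotmod_add.
Proof.
by elim/quotmod_ind=> x; rewrite quotmod_oppE !quotmod_addE addNr.
Qed.

HB.instance Definition _ := GRing.isZmodule.Build quotmod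
  quotmod_addA quotmod_addC quotmod_add0 quotmod_addN.

Let quotmod_plusE v w : quotmod_pi v + quotmod_pi w = quotmod_pi (v + w).
Proof. exact: quotmod_addE. Qed.

Fact quotmod_scaleA a b x :
  quotmod_scale a (quotmod_scale b x) = quotmod_scale (a * b) x.
Proof. by elim/quotmod_ind: x => x; rewrite !quotmod_scaleE scalerA. Qed.
Fact quotmod_scale1 : left_id 1 quotmod_scale.
Proof. by elim/quotmod_ind=> x; rewrite !quotmod_scaleE scale1r. Qed.
Fact quotmod_scaleDr : right_distributive quotmod_scale +%R.
Proof.
move=> a; elim/quotmod_ind=> x; elim/quotmod_ind=> y.
by rewrite quotmod_plusE !quotmod_scaleE quotmod_plusE scalerDr.
Qed.
Fact quotmod_scaleDl x :
  {morph quotmod_scale^~ x : a b / a + b}.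
Proof.
move=> a b; elim/quotmod_ind: x => x.
by rewrite !quotmod_scaleE quotmod_plusE scalerDl.
Qed.

HB.instance Definition _ := GRing.Zmodule_isLmodule.Build A quotmod
  quotmod_scaleA quotmod_scale1 quotmod_scaleDr quotmod_scaleDl.

End QuotientModule.

Section InducedModule.
Variables (A B : pzRingType) (i : {rmorphism B -> A}) (N : lmodType B).

(* The tensor product [A (x)_B N], with A a right B-module through i: formal
   sums of pure tensors modulo the least congruence that gives an abelian
   group and a B-balanced biadditive map [(a, n) |-> a (x) n]. *)
Inductive tensor_term :=
  | TPure of A & N
  | TZero
  | TOpp of tensor_term
  | TAdd of tensor_term & tensor_term.

Inductive tensor_cong : tensor_term -> tensor_term -> Prop :=
  | TC_refl t : tensor_cong t t
  | TC_sym s t : tensor_cong s t -> tensor_cong t s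
  | TC_trans s t u : tensor_cong s t -> tensor_cong t u -> tensor_cong s u
  | TC_opp s t : tensor_cong s t -> tensor_cong (TOpp s) (TOpp t)
  | TC_add s s' t t' : tensor_cong s s' -> tensor_cong t t' ->
      tensor_cong (TAdd s t) (TAdd s' t')
  | TC_addA s t u : tensor_cong (TAdd s (TAdd t u)) (TAdd (TAdd s t) u)
  | TC_addC s t : tensor_cong (TAdd s t) (TAdd t s)
  | TC_add0 t : tensor_cong (TAdd TZero t) t
  | TC_addN t : tensor_cong (TAdd (TOpp t) t) TZero
  | TC_pureDl a b n :
      tensor_cong (TPure (a + b) n) (TAdd (TPure a n) (TPure b n))
  | TC_pureDr a m n :
      tensor_cong (TPure a (m + n)) (TAdd (TPure a m) (TPure a n))
  | TC_balanced a b n : tensor_cong (TPure (a * i b) n) (TPure a (b *: n)).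

HB.instance Definition _ := gen_eqMixin tensor_term.
HB.instance Definition _ := gen_choiceMixin tensor_term.

Definition tensor_rel (s t : tensor_term) : bool := `[< tensor_cong s t >].

Lemma tensor_rel_refl : reflexive tensor_rel.
Proof. by move=> t; apply/asboolP/TC_refl. Qed.
Lemma tensor_rel_sym : symmetric tensor_rel.
Proof. by move=> s t; apply/asboolP/asboolP => /TC_sym. Qed.
Lemma tensor_rel_trans : transitive tensor_rel.
Proof.
by move=> t s u /asboolP st /asboolP tu; apply/asboolP/(TC_trans st tu).
Qed.

Canonical tensor_equiv :=
  EquivRel tensor_rel tensor_rel_refl tensor_rel_sym tensor_rel_trans.

Definition tensor_module := {eq_quot tensor_equiv}.

HB.instance Definition _ := Choice.on tensor_module.
HB.instance Definition _ := EqQuotient.on tensor_module.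

Definition tensor_pi (t : tensor_term) : tensor_module := \pi_tensor_module t.

Lemma tensor_piP s t : tensor_pi s = tensor_pi t <-> tensor_cong s t.
Proof.
split=> [/eqmodP|H]; first by move=> /asboolP.
by apply/eqmodP/asboolP.
Qed.

Lemma tensor_ind (P : tensor_module -> Prop) :
  (forall t, P (tensor_pi t)) -> forall x, P x.
Proof. by move=> H x; rewrite -(reprK x); apply: H. Qed.

Lemma tensor_repr t : tensor_cong (repr (tensor_pi t)) t.
Proof. by apply/tensor_piP; rewrite /tensor_pi reprK. Qed.

Definition tensor_add (x y : tensor_module) := tensor_pi (TAdd (repr x) (repr y)).
Definition tensor_opp (x : tensor_module) := tensor_pi (TOpp (repr x)).

Fixpoint tensor_act (a : A) (t : tensor_term) : tensor_term :=
  match t with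
  | TPure b n => TPure (a * b) n
  | TZero => TZero
  | TOpp s => TOpp (tensor_act a s)
  | TAdd s u => TAdd (tensor_act a s) (tensor_act a u)
  end.

Lemma tensor_act_cong a s t :
  tensor_cong s t -> tensor_cong (tensor_act a s) (tensor_act a t).
Proof.
elim=> /= *; rewrite ?mulrDr ?mulrA; by [constructor | eauto using tensor_cong].
Qed.

Definition tensor_scale (a : A) (x : tensor_module) :=
  tensor_pi (tensor_act a (repr x)).

Lemma tensor_addE s t :
  tensor_add (tensor_pi s) (tensor_pi t) = tensor_pi (TAdd s t).
Proof. by apply/tensor_piP; apply: TC_add; apply: tensor_repr. Qed.
Lemma tensor_oppE t : tensor_opp (tensor_pi t) = tensor_pi (TOpp t).
Proof. by apply/tensor_piP; apply: TC_opp; apply: tensor_repr. Qed.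
Lemma tensor_scaleE a t :
  tensor_scale a (tensor_pi t) = tensor_pi (tensor_act a t).
Proof. by apply/tensor_piP; apply: tensor_act_cong; apply: tensor_repr. Qed.

Fact tensor_addA : associative tensor_add.
Proof.
elim/tensor_ind=> x; elim/tensor_ind=> y; elim/tensor_ind=> z.
by rewrite !tensor_addE; apply/tensor_piP; constructor.
Qed.
Fact tensor_addC : commutative tensor_add.
Proof.
elim/tensor_ind=> x; elim/tensor_ind=> y.
by rewrite !tensor_addE; apply/tensor_piP; constructor.
Qed.
Fact tensor_add0 : left_id (tensor_pi TZero) tensor_add.
Proof.
by elim/tensor_ind=> x; rewrite !tensor_addE; apply/tensor_piP; constructor.
Qed.
Fact tensor_addN : left_inverse (tensor_pi TZero) tensor_opp tensor_add.
Proof.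
elim/tensor_ind=> x; rewrite tensor_oppE !tensor_addE.
by apply/tensor_piP; constructor.
Qed.

HB.instance Definition _ := GRing.isZmodule.Build tensor_module
  tensor_addA tensor_addC tensor_add0 tensor_addN.

Let tensor_plusE s t : tensor_pi s + tensor_pi t = tensor_pi (TAdd s t).
Proof. exact: tensor_addE. Qed.
Let tensor_minusE t : - tensor_pi t = tensor_pi (TOpp t).
Proof. exact: tensor_oppE. Qed.

Fact tensor_scaleA a b x :
  tensor_scale a (tensor_scale b x) = tensor_scale (a * b) x.
Proof.
elim/tensor_ind: x => x; rewrite !tensor_scaleE; congr tensor_pi.
by elim: x => //= [c n|s ->|s -> t ->]; rewrite ?mulrA.
Qed.
Fact tensor_scale1 : left_id 1 tensor_scale.
Proof.
elim/tensor_ind=> x; rewrite !tensor_scaleE; congr tensor_pi.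
by elim: x => //= [c n|s ->|s -> t ->]; rewrite ?mul1r.
Qed.
Fact tensor_scaleDr : right_distributive tensor_scale +%R.
Proof.
move=> a; elim/tensor_ind=> x; elim/tensor_ind=> y.
by rewrite tensor_plusE !tensor_scaleE tensor_plusE.
Qed.
Fact tensor_scaleDl x : {morph tensor_scale^~ x : a b / a + b}.
Proof.
move=> a b; elim/tensor_ind: x => x.
rewrite !tensor_scaleE; elim: x => [c n||s IH|s IHs t IHt] /=.
- rewrite tensor_plusE; apply/tensor_piP.
  by rewrite mulrDl; constructor.
- by rewrite tensor_plusE; apply/tensor_piP/TC_sym; constructor.
- by rewrite -!tensor_minusE IH opprD.
- by rewrite -!tensor_plusE IHs IHt addrACA.
Qed.

HB.instance Definition _ := GRing.Zmodule_isLmodule.Build A tensor_module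
  tensor_scaleA tensor_scale1 tensor_scaleDr tensor_scaleDl.

Definition tensor_pure (a : A) (n : N) : tensor_module := tensor_pi (TPure a n).

End InducedModule.

(** * The algebra U_q(sl(2,C)), by generators and relations *)

Section Uq.
Variables (R : realType) (q : R).

(* Noncommutative polynomials in E, F, K, K^-1, modulo the least congruence
   containing the axioms of a unital C-algebra and the defining relations.
   Opposites are products with the constant -1. *)
Inductive uterm :=
  | UC of R[i] | UE | UF | UK | UKV
  | UAdd of uterm & uterm
  | UMul of uterm & uterm.

Local Notation cq := (q%:C).

Inductive ucong : uterm -> uterm -> Prop :=
  | Ur_refl x : ucong x x
  | Ur_sym x y : ucong x y -> ucong y x
  | Ur_trans x y z : ucong x y -> ucong y z -> ucong x z
  | Ur_add x x' y y' : ucong x x' -> ucong y y' ->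
      ucong (UAdd x y) (UAdd x' y')
  | Ur_mul x x' y y' : ucong x x' -> ucong y y' ->
      ucong (UMul x y) (UMul x' y')
  | Ur_addA x y z : ucong (UAdd x (UAdd y z)) (UAdd (UAdd x y) z)
  | Ur_addC x y : ucong (UAdd x y) (UAdd y x)
  | Ur_add0 x : ucong (UAdd (UC 0) x) x
  | Ur_addN x : ucong (UAdd (UMul (UC (-1)) x) x) (UC 0)
  | Ur_mulA x y z : ucong (UMul x (UMul y z)) (UMul (UMul x y) z)
  | Ur_mul1l x : ucong (UMul (UC 1) x) x
  | Ur_mul1r x : ucong (UMul x (UC 1)) x
  | Ur_mulDl x y z :
      ucong (UMul (UAdd x y) z) (UAdd (UMul x z) (UMul y z))
  | Ur_mulDr x y z :
      ucong (UMul x (UAdd y z)) (UAdd (UMul x y) (UMul x z))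
  | Ur_CD a b : ucong (UC (a + b)) (UAdd (UC a) (UC b))
  | Ur_CM a b : ucong (UC (a * b)) (UMul (UC a) (UC b))
  | Ur_Ccentral a x : ucong (UMul (UC a) x) (UMul x (UC a))
  | Ur_KKV : ucong (UMul UK UKV) (UC 1)
  | Ur_KVK : ucong (UMul UKV UK) (UC 1)
  | Ur_KE : ucong (UMul UK UE) (UMul (UC (cq ^+ 2)) (UMul UE UK))
  | Ur_KF : ucong (UMul UK UF) (UMul (UC (cq ^- 2)) (UMul UF UK))
  | Ur_EF : ucong (UAdd (UMul UE UF) (UMul (UC (-1)) (UMul UF UE)))
      (UMul (UC (cq - cq^-1)^-1) (UAdd UK (UMul (UC (-1)) UKV))).

HB.instance Definition _ := gen_eqMixin uterm.
HB.instance Definition _ := gen_choiceMixin uterm.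

Definition urel (x y : uterm) : bool := `[< ucong x y >].

Lemma urel_refl : reflexive urel.
Proof. by move=> t; apply/asboolP/Ur_refl. Qed.
Lemma urel_sym : symmetric urel.
Proof. by move=> s t; apply/asboolP/asboolP => /Ur_sym. Qed.
Lemma urel_trans : transitive urel.
Proof.
by move=> t s u /asboolP st /asboolP tu; apply/asboolP/(Ur_trans st tu).
Qed.

Canonical uequiv := EquivRel urel urel_refl urel_sym urel_trans.

Definition Uq := {eq_quot uequiv}.

HB.instance Definition _ := Choice.on Uq.
HB.instance Definition _ := EqQuotient.on Uq.

Definition upi (t : uterm) : Uq := \pi_Uq t.

Lemma upiP s t : upi s = upi t <-> ucong s t.
Proof.
split=> [/eqmodP|H]; first by move=> /asboolP.
by apply/eqmodP/asboolP.
Qed.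

Lemma upi_ind (P : Uq -> Prop) : (forall t, P (upi t)) -> forall x, P x.
Proof. by move=> H x; rewrite -(reprK x); apply: H. Qed.

Lemma upi_repr t : ucong (repr (upi t)) t.
Proof. by apply/upiP; rewrite /upi reprK. Qed.

Definition uadd (x y : Uq) := upi (UAdd (repr x) (repr y)).
Definition umul (x y : Uq) := upi (UMul (repr x) (repr y)).
Definition uopp (x : Uq) := upi (UMul (UC (-1)) (repr x)).
Definition uscale (a : R[i]) (x : Uq) := upi (UMul (UC a) (repr x)).

Lemma uaddE s t : uadd (upi s) (upi t) = upi (UAdd s t).
Proof. by apply/upiP; apply: Ur_add; apply: upi_repr. Qed.
Lemma umulE s t : umul (upi s) (upi t) = upi (UMul s t).
Proof. by apply/upiP; apply: Ur_mul; apply: upi_repr. Qed.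
Lemma uoppE t : uopp (upi t) = upi (UMul (UC (-1)) t).
Proof. by apply/upiP; apply: Ur_mul; [apply: Ur_refl | apply: upi_repr]. Qed.
Lemma uscaleE a t : uscale a (upi t) = upi (UMul (UC a) t).
Proof. by apply/upiP; apply: Ur_mul; [apply: Ur_refl | apply: upi_repr]. Qed.

Local Ltac ulift := rewrite ?umulE ?uscaleE ?uoppE ?uaddE.

Fact uaddA : associative uadd.
Proof.
elim/upi_ind=> x; elim/upi_ind=> y; elim/upi_ind=> z; ulift.
by apply/upiP; constructor.
Qed.
Fact uaddC : commutative uadd.
Proof. by elim/upi_ind=> x; elim/upi_ind=> y; ulift; apply/upiP; constructor. Qed.
Fact uadd0 : left_id (upi (UC 0)) uadd.
Proof. by elim/upi_ind=> x; ulift; apply/upiP; constructor. Qed.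
Fact uaddN : left_inverse (upi (UC 0)) uopp uadd.
Proof. by elim/upi_ind=> x; ulift; apply/upiP; constructor. Qed.

HB.instance Definition _ := GRing.isZmodule.Build Uq uaddA uaddC uadd0 uaddN.

Lemma upiD s t : upi s + upi t = upi (UAdd s t).
Proof. exact: uaddE. Qed.
Lemma upiN t : - upi t = upi (UMul (UC (-1)) t).
Proof. exact: uoppE. Qed.

Fact umulA : associative umul.
Proof.
elim/upi_ind=> x; elim/upi_ind=> y; elim/upi_ind=> z; ulift.
by apply/upiP; constructor.
Qed.
Fact umul1l : left_id (upi (UC 1)) umul.
Proof. by elim/upi_ind=> x; ulift; apply/upiP; constructor. Qed.
Fact umul1r : right_id (upi (UC 1)) umul.
Proof. by elim/upi_ind=> x; ulift; apply/upiP; constructor. Qed.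
Fact umulDl : left_distributive umul +%R.
Proof.
elim/upi_ind=> x; elim/upi_ind=> y; elim/upi_ind=> z.
by rewrite [upi x + _]upiD !umulE upiD; apply/upiP; constructor.
Qed.
Fact umulDr : right_distributive umul +%R.
Proof.
elim/upi_ind=> x; elim/upi_ind=> y; elim/upi_ind=> z.
by rewrite [upi y + _]upiD !umulE upiD; apply/upiP; constructor.
Qed.

(* The trivial representation shows that the presentation does not collapse. *)
Fixpoint ucounit (t : uterm) : R[i] :=
  match t with
  | UC a => a | UE => 0 | UF => 0 | UK => 1 | UKV => 1
  | UAdd x y => ucounit x + ucounit y
  | UMul x y => ucounit x * ucounit y
  end.

Lemma ucounit_cong x y : ucong x y -> ucounit x = ucounit y.
Proof.
elim=> //=; try by move=> *; congruence.
all: by move=> *; ring.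
Qed.

Fact uone_neq0 : upi (UC 1) != 0.
Proof.
apply/eqP => /upiP /ucounit_cong /= /eqP; by rewrite oner_eq0.
Qed.

HB.instance Definition _ := GRing.Zmodule_isNzRing.Build Uq
  umulA umul1l umul1r umulDl umulDr uone_neq0.

Lemma upiM s t : upi s * upi t = upi (UMul s t).
Proof. exact: umulE. Qed.

Fact uscaleA a b x : uscale a (uscale b x) = uscale (a * b) x.
Proof.
elim/upi_ind: x => x; ulift; apply/upiP.
apply: Ur_trans (Ur_mulA _ _ _) _.
by apply: Ur_mul (Ur_refl _); apply/Ur_sym/Ur_CM.
Qed.
Fact uscale1 : left_id 1 uscale.
Proof. by elim/upi_ind=> x; ulift; apply/upiP; constructor. Qed.
Fact uscaleDr : right_distributive uscale +%R.
Proof.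
move=> a; elim/upi_ind=> x; elim/upi_ind=> y.
by rewrite [upi x + _]upiD !uscaleE upiD; apply/upiP; constructor.
Qed.
Fact uscaleDl x : {morph uscale^~ x : a b / a + b}.
Proof.
move=> a b; elim/upi_ind: x => x.
rewrite !uscaleE upiD; apply/upiP.
apply: Ur_trans (Ur_mulDl _ _ _).
by apply: Ur_mul (Ur_refl _); apply: Ur_CD.
Qed.

HB.instance Definition _ := GRing.Zmodule_isLmodule.Build R[i] Uq
  uscaleA uscale1 uscaleDr uscaleDl.

Lemma upiZ a t : a *: upi t = upi (UMul (UC a) t).
Proof. exact: uscaleE. Qed.

Fact uscaleAl (a : R[i]) (x y : Uq) : a *: (x * y) = a *: x * y.
Proof.
elim/upi_ind: x => x; elim/upi_ind: y => y.
by rewrite [a *: upi x]upiZ !upiM upiZ; apply/upiP; constructor.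
Qed.

HB.instance Definition _ := GRing.Lmodule_isLalgebra.Build R[i] Uq uscaleAl.

Fact uscaleAr (a : R[i]) (x y : Uq) : a *: (x * y) = x * (a *: y).
Proof.
elim/upi_ind: x => x; elim/upi_ind: y => y.
rewrite [a *: upi y]upiZ !upiM upiZ; apply/upiP.
apply: Ur_trans (Ur_mulA _ _ _) _.
apply: Ur_trans (Ur_sym (Ur_mulA _ _ _)).
by apply: Ur_mul (Ur_refl _); apply: Ur_Ccentral.
Qed.

HB.instance Definition _ := GRing.Lalgebra_isAlgebra.Build R[i] Uq uscaleAr.

Definition gE : Uq := upi UE.
Definition gF : Uq := upi UF.
Definition gK : Uq := upi UK.
Definition gKV : Uq := upi UKV.

Lemma gKKV : gK * gKV = 1.
Proof. by rewrite upiM; apply/upiP; constructor. Qed.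
Lemma gKVK : gKV * gK = 1.
Proof. by rewrite upiM; apply/upiP; constructor. Qed.
Lemma gKE : gK * gE = cq ^+ 2 *: (gE * gK).
Proof. by rewrite !upiM upiZ; apply/upiP; constructor. Qed.
Lemma gKF : gK * gF = cq ^- 2 *: (gF * gK).
Proof. by rewrite !upiM upiZ; apply/upiP; constructor. Qed.
Lemma gEF : gE * gF - gF * gE = (cq - cq^-1)^-1 *: (gK - gKV).
Proof. by rewrite !upiM !upiN !upiD upiZ; apply/upiP; constructor. Qed.

Definition casimir : Uq :=
  gE * gF + (cq - cq^-1) ^- 2 *: (cq^-1 *: gK + cq *: gKV).

(* The involution of U_q(su(1,1)), the antilinear anti-automorphism given on
   generators; see [ustar_cong] and the lemmas that follow it. *)

Fixpoint ustar (t : uterm) : Uq :=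
  match t with
  | UC a => (Num.conj a) *: 1
  | UE => - (gF * gK)
  | UF => - (gKV * gE)
  | UK => gK
  | UKV => gKV
  | UAdd x y => ustar x + ustar y
  | UMul x y => ustar y * ustar x
  end.

Definition star (x : Uq) : Uq := ustar (repr x).

(* The centralizer of K. *)
Definition U0_pred : {pred Uq} := fun x => x * gK == gK * x.

Fact U0_subalg : GRing.subalg_closed U0_pred.
Proof.
split=> [|a x y|x y]; rewrite !unfold_in.
- by rewrite mul1r mulr1.
- move=> /eqP xK /eqP yK.
  by rewrite mulrDl mulrDr -scalerAl xK yK scalerAr.
- by move=> /eqP xK /eqP yK; rewrite -mulrA yK mulrA xK mulrA.
Qed.

HB.instance Definition _ :=
  GRing.isSubalgClosed.Build R[i] Uq U0_pred U0_subalg.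

Definition U0 := {x : Uq | U0_pred x}.

HB.instance Definition _ := SubChoice.on U0.
HB.instance Definition _ := [SubChoice_isSubAlgebra of U0 by <:].

End Uq.

Lemma gKEF (R : realType) (q : R) :
  gK q * (gE q * gF q) = gE q * gF q * gK q.
Proof.
have [q0|q0] := eqVneq q 0.
  suff -> : gE q = 0 by rewrite !(mul0r, mulr0).
  have := gKE q; rewrite q0 expr0n scale0r => KE0.
  by rewrite -[gE 0]mul1r -(gKVK 0) -mulrA KE0 mulr0.
have cq0 : q%:C != 0 by rewrite (inj_eq (@complexI R)).
rewrite mulrA gKE -scalerAl -!mulrA gKF -scalerAr scalerA.
by rewrite mulfV ?scale1r // expf_neq0.
Qed.

Section Star.
Variables (R : realType) (q : R).
Hypothesis q0 : q != 0.

Local Notation cq := (q%:C).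
Local Notation U := (Uq q).
Local Notation E := (gE q).
Local Notation F := (gF q).
Local Notation K := (gK q).
Local Notation KV := (gKV q).

Let cq0 : cq != 0 :> R[i].
Proof. by rewrite (inj_eq (@complexI R)). Qed.
Let conj_cq : Num.conj cq = cq.
Proof. exact: conjc_real. Qed.

Lemma gEK : E * K = cq ^- 2 *: (K * E).
Proof. by rewrite gKE scalerA mulVf ?scale1r // expf_neq0. Qed.
Lemma gFK : F * K = cq ^+ 2 *: (K * F).
Proof. by rewrite gKF scalerA mulfV ?scale1r // expf_neq0. Qed.
Lemma gKVE : KV * E = cq ^- 2 *: (E * KV).
Proof.
rewrite -[LHS]mulr1 -(gKKV q) mulrA -(mulrA KV) gEK -scalerAr -scalerAl.
by rewrite mulrA gKVK mul1r.
Qed.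
Lemma ustar_cong x y : ucong q x y -> ustar q x = ustar q y.
Proof.
elim=> //=.
- by move=> x1 y1 z1 _ -> _ ->.
- by move=> x1 x2 y1 y2 _ -> _ ->.
- by move=> x1 x2 y1 y2 _ -> _ ->.
- by move=> *; rewrite addrA.
- by move=> *; rewrite addrC.
- by move=> *; rewrite rmorph0 scale0r add0r.
- by move=> *; rewrite rmorphN rmorph1 rmorph0 scale0r -scalerAr mulr1 scaleN1r addNr.
- by move=> *; rewrite mulrA.
- by move=> *; rewrite rmorph1 scale1r mulr1.
- by move=> *; rewrite rmorph1 scale1r mul1r.
- by move=> *; rewrite mulrDr.
- by move=> *; rewrite mulrDl.
- by move=> *; rewrite rmorphD scalerDl.
- by move=> a b; rewrite rmorphM -scalerAl mul1r scalerA mulrC.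
- by move=> *; rewrite -scalerAl -scalerAr mul1r mulr1.
- by rewrite gKVK rmorph1 scale1r.
- by rewrite gKKV rmorph1 scale1r.
- rewrite -scalerAr mulr1 rmorphXn /= conj_cq mulNr mulrN scalerN; congr (- _).
  by rewrite {1}gFK -scalerAl mulrA.
- rewrite -scalerAr mulr1 fmorphV rmorphXn /= conj_cq mulNr mulrN scalerN.
  congr (- _); rewrite mulrA gKKV mul1r -mulrA gEK -scalerAr mulrA gKVK mul1r.
  by [].
- rewrite -!scalerAr !mulr1 rmorphN rmorph1 !scaleN1r fmorphV rmorphB fmorphV /=.
  rewrite conj_cq !mulNr !opprK -gEF; congr (_ - _).
    by rewrite -mulrA [E * (F * K)]mulrA -gKEF [KV * _]mulrA gKVK mul1r.
  by rewrite -mulrA [K * (KV * E)]mulrA gKKV mul1r.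
Qed.

Lemma star_upi t : star (upi q t) = ustar q t.
Proof. by apply/ustar_cong/upi_repr. Qed.

Lemma starD x y : star (x + y) = star x + star y :> U.
Proof.
by elim/upi_ind: x => x; elim/upi_ind: y => y; rewrite upiD !star_upi.
Qed.
Lemma starM x y : star (x * y) = star y * star x :> U.
Proof.
by elim/upi_ind: x => x; elim/upi_ind: y => y; rewrite upiM !star_upi.
Qed.
Lemma starZ a x : star (a *: x) = Num.conj a *: star x :> U.
Proof.
elim/upi_ind: x => x; rewrite upiZ !star_upi /=.
by rewrite -scalerAr mulr1.
Qed.
Lemma star1 : star 1 = 1 :> U.
Proof. by rewrite star_upi /= rmorph1 scale1r. Qed.
Lemma starE : star E = - (F * K).
Proof. exact: star_upi. Qed.
Lemma starF : star F = - (KV * E).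
Proof. exact: star_upi. Qed.
Lemma starK : star K = K.
Proof. exact: star_upi. Qed.
Lemma starKV : star KV = KV.
Proof. exact: star_upi. Qed.
Lemma starN x : star (- x) = - star x :> U.
Proof. by rewrite -scaleN1r starZ rmorphN rmorph1 scaleN1r. Qed.

Lemma star_star (x : U) : star (star x) = x.
Proof.
elim/upi_ind: x; elim => [a|||||x IHx y IHy|x IHx y IHy].
- rewrite star_upi /= starZ star1 conjCK.
  rewrite upiZ.
  by apply/upiP; apply: Ur_mul1r.
- by rewrite starE starN starM starK starF mulrN opprK mulrA gKKV mul1r.
- by rewrite starF starN starM starKV starE mulNr opprK -mulrA gKKV mulr1.
- by rewrite !starK.
- by rewrite !starKV.
- by rewrite -upiD !starD IHx IHy.
- by rewrite -upiM !starM IHx IHy.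
Qed.

End Star.

(** * The modules M(C_{lambda,mu}) *)

Section Induction.
Variables (R : realType) (q : R).

Fact U0K_subproof : U0_pred (gK q).
Proof. exact: eqxx. Qed.
Definition U0K : U0 q := exist _ (gK q) U0K_subproof.

Fact U0EF_subproof : U0_pred (gE q * gF q).
Proof. by apply/eqP/esym/gKEF. Qed.
Definition U0EF : U0 q := exist _ (gE q * gF q) U0EF_subproof.

(* An action of U_0 on the line [R[i]] (the complex numbers) is the same thing
   as a unital algebra morphism U_0 -> R[i]; see [U0_char_inhabited]. *)
Record U0_char (lam mu : R[i]) := U0Char {
  U0_char_fun :> {lrmorphism U0 q -> R[i]^o};
  U0_charK : U0_char_fun U0K = lam;
  U0_charEF : U0_char_fun U0EF = mu
}.

Variables (lam mu : R[i]) (chi : U0_char lam mu).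

Definition line (_ : U0_char lam mu) : Type := R[i].

HB.instance Definition _ := GRing.Zmodule.on (line chi).

Definition line_scale (u : U0 q) (z : line chi) : line chi :=
  (chi u : R[i]) * z.

Fact line_scaleA u v z : line_scale u (line_scale v z) = line_scale (u * v) z.
Proof. by rewrite /line_scale rmorphM mulrA. Qed.
Fact line_scale1 : left_id 1 line_scale.
Proof. by move=> z; rewrite /line_scale rmorph1 mul1r. Qed.
Fact line_scaleDr : right_distributive line_scale +%R.
Proof. by move=> u x y; rewrite /line_scale mulrDr. Qed.
Fact line_scaleDl z : {morph line_scale^~ z : u v / u + v}.
Proof. by move=> u v; rewrite /line_scale rmorphD mulrDl. Qed.

HB.instance Definition _ := GRing.Zmodule_isLmodule.Build (U0 q) (line chi)
  line_scaleA line_scale1 line_scaleDr line_scaleDl.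

Definition Mchi : lmodType (Uq q) :=
  tensor_module (\val : {rmorphism U0 q -> Uq q}) (line chi).

Definition Mchi1 : Mchi := @tensor_pure _ _ _ (line chi) 1 (1 : R[i]).

End Induction.

(* The line C_{lambda,mu} exists: U acts on functions on Z, with K diagonal and
   E, F shifting the index, and U_0 acts on the delta function at 0 by the
   required scalars. *)

Section CharExists.
Variables (R : realType) (q : R) (lam mu : R[i]).
Hypotheses (q0 : 0 < q) (q1 : q < 1) (lam0 : lam != 0).
Local Notation C := R[i].
Local Notation cq := (q%:C).

Let cq0 : cq != 0 :> C.
Proof. by rewrite (inj_eq (@complexI R)) gt_eqF. Qed.

Let cq2 : cq - cq^-1 != 0.
Proof.
apply/eqP => /eqP; rewrite subr_eq0 => /eqP E.
have : cq ^+ 2 == 1 by rewrite expr2 {2}E mulfV.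
rewrite -rmorphXn -(rmorph1 (real_complex R)) (inj_eq (@complexI R)).
by rewrite expr2 lt_eqF // mulr_ilt1 // ltW.
Qed.

Let wt (n : int) : C := lam * cq ^ (n * 2).
Let cas (x : C) : C := (cq^-1 * x + cq * x^-1) / (cq - cq^-1) ^+ 2.
Let mun (n : int) : C := mu + (cas lam - cas (wt n)).

Let wt_neq0 n : wt n != 0.
Proof. by rewrite mulf_neq0 // expfz_neq0. Qed.

Let wtS n : wt (n + 1) = cq ^+ 2 * wt n.
Proof.
by rewrite /wt mulrDl mul1r expfzDr // [LHS]mulrA [LHS]mulrC.
Qed.

Let wt0 : wt 0 = lam.
Proof. by rewrite /wt mul0r expr0z mulr1. Qed.

Let wt_eq_lam n : wt n = lam -> n = 0.
Proof.
move=> /(congr1 (fun z => lam^-1 * z)); rewrite mulKf // mulVf //.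
rewrite -fmorphXz -(rmorph1 (real_complex R)) => /complexI.
rewrite -(expr0z q) => /ieexprIz -/(_ q0); rewrite lt_eqF // => /(_ isT).
by move=> /eqP; rewrite mulf_eq0 orbF => /eqP.
Qed.

Let munS n : mun n - mun (n + 1) = (wt n - (wt n)^-1) / (cq - cq^-1).
Proof.
rewrite /mun /cas wtS; field.
rewrite cq0 wt_neq0 lam0 andbT /= (_ : _ - 1 = cq * (cq - cq^-1)).
  by rewrite mulf_neq0.
by rewrite mulrBr mulfV.
Qed.

Local Notation fct := (int -> C).

Fixpoint fact (t : uterm R) (f : fct) : fct :=
  match t with
  | UC a => fun n => a * f n
  | UE => fun n => f (n - 1)
  | UF => fun n => mun (n + 1) * f (n + 1)
  | UK => fun n => wt n * f n
  | UKV => fun n => (wt n)^-1 * f n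
  | UAdd x y => fun n => fact x f n + fact y f n
  | UMul x y => fact x (fact y f)
  end.

Let fact_lin t : forall a (f g : fct),
  fact t (fun n => a * f n + g n) = (fun n => a * fact t f n + fact t g n).
Proof.
elim: t => [c|||||x IHx y IHy|x IHx y IHy] a f g /=;
  try by apply/funext => n; ring.
- by rewrite IHx IHy; apply/funext => n; ring.
- by rewrite IHy IHx.
Qed.

Let factD t (f g : fct) :
  fact t (fun n => f n + g n) = (fun n => fact t f n + fact t g n).
Proof.
have := fact_lin t 1 f g.
under eq_fun do rewrite mul1r.
by move=> ->; apply/funext => n; rewrite mul1r.
Qed.

Let fact0 t : fact t (fun=> 0) = (fun=> 0).
Proof.
have := fact_lin t (-1) (fun=> 0) (fun=> 0).
under eq_fun do rewrite mulr0 addr0.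
by move=> ->; apply/funext => n; ring.
Qed.

Let factZ t a (f : fct) :
  fact t (fun n => a * f n) = (fun n => a * fact t f n).
Proof.
have := fact_lin t a f (fun=> 0).
under eq_fun do rewrite addr0.
by move=> ->; apply/funext => n; rewrite fact0 addr0.
Qed.

Let fact_cong s t : ucong q s t -> forall f, fact s f = fact t f.
Proof.
elim=> //=.
- by move=> x y z _ e1 _ e2 f; rewrite e1.
- by move=> x x' y y' _ e1 _ e2 f; rewrite e1 e2.
- by move=> x x' y y' _ e1 _ e2 f; rewrite e1 e2.
- by move=> x y z f; apply/funext => n; rewrite addrA.
- by move=> x y f; apply/funext => n; rewrite addrC.
- by move=> x f; apply/funext => n; ring.
- by move=> x f; apply/funext => n; ring.
- by move=> x f; apply/funext => n; ring.
- by move=> x f; congr (fact x _); apply/funext => n; ring.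
- by move=> a b f; apply/funext => n; ring.
- by move=> a b f; apply/funext => n; ring.
- by move=> f; apply/funext => n; rewrite mulVKf // mul1r.
- by move=> f; apply/funext => n; rewrite mulKf // mul1r.
- by move=> f; apply/funext => n; rewrite -{1}(subrK 1 n) wtS mulrA.
- move=> f; apply/funext => n; rewrite wtS.
  by field.
- move=> f; apply/funext => n; rewrite subrK addrK mulN1r -mulrBl munS; ring.
Qed.

Let delta : fct := fun n => (n == 0)%:R.

Let chi0 (u : U0 q) : C := fact (repr (val u)) delta 0.

Let fact_repr t : fact (repr (upi q t)) = fact t.
Proof. by apply/funext => f; apply: fact_cong; apply: upi_repr. Qed.

Let chi0P (u : U0 q) :
  fact (repr (val u)) delta = (fun n => chi0 u * delta n).
Proof.
case: u => u uU0 /=.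
have E : u * gK q = gK q * u by apply/eqP; exact: uU0.
rewrite /chi0 /=; move: E; elim/upi_ind: u {uU0} => t.
rewrite !upiM => /upiP /fact_cong /(_ delta) /= E.
rewrite fact_repr; apply/funext => n; rewrite /delta.
have [->|n0] := eqVneq n 0; first by rewrite mulr1.
rewrite mulr0; move/(congr1 (fun f => f n)): E => /=.
have -> : (fun n => wt n * delta n) = (fun n => lam * delta n).
  apply/funext => m; rewrite /delta.
  by have [->|_] := eqVneq m 0; rewrite ?wt0 ?mulr0.
rewrite factZ => /eqP; rewrite -subr_eq0 -mulrBl mulf_eq0 => /orP[|/eqP //].
by rewrite subr_eq0 => /eqP /esym /wt_eq_lam /eqP; rewrite (negbTE n0).
Qed.

Let chi0D (a : C) (u v : U0 q) : chi0 (a *: u + v) = a * chi0 u + chi0 v.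
Proof.
rewrite /chi0 (_ : val _ = a *: val u + val v) //.
move: (val u) (val v) => {u v}; elim/upi_ind=> u; elim/upi_ind=> v.
by rewrite upiZ upiD !fact_repr.
Qed.

Let chi0M (u v : U0 q) : chi0 (u * v) = chi0 u * chi0 v.
Proof.
transitivity (fact (repr (val u)) (fact (repr (val v)) delta) 0).
  rewrite /chi0 (_ : val (u * v) = val u * val v) //.
  move: (val u) (val v) => {u v}; elim/upi_ind=> u; elim/upi_ind=> v.
  by rewrite upiM !fact_repr.
by rewrite chi0P factZ mulrC.
Qed.

Let chi01 : chi0 1 = 1.
Proof. by rewrite /chi0 /= fact_repr /= mul1r. Qed.

Lemma U0_char_inhabited : inhabited (U0_char q lam mu).
Proof.
pose c : U0 q -> R[i]^o := chi0.
have lin : linear c by exact: chi0D.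
have mul : monoid_morphism c by split; [exact: chi01 | exact: chi0M].
pose l := GRing.isLinear.Build _ _ _ _ c lin.
pose m := GRing.isMonoidMorphism.Build _ _ c mul.
pose c' : {lrmorphism U0 q -> R[i]^o} := HB.pack c l m.
apply: inhabits; apply: (@U0Char _ _ _ _ c').
- by rewrite /= /c /chi0 /= fact_repr /= wt0 mulr1.
- rewrite /= /c /chi0 /= [gE q * _]upiM fact_repr /= subrK /mun wt0 subrr.
  by rewrite addr0 mulr1.
Qed.

End CharExists.

(** * Unitary modules *)

Section UModules.
Variables (R : realType) (q : R).
Local Notation U := (Uq q).
Local Notation C := R[i].

(* A left U-module is a complex vector space through the constants of U. *)
Definition cscale (V : lmodType U) (a : C) (v : V) : V := (a%:A : U) *: v.

(* The complex linear span of a family of vectors. *)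
Definition cspan (V : lmodType U) (I : Type) (f : I -> V) : set V :=
  [set v | exists (n : nat) (i : 'I_n -> I) (c : 'I_n -> C),
     v = \sum_(j < n) cscale (c j) (f (i j))].

Definition inner_product (V : lmodType U) (ip : V -> V -> C) : Prop :=
  [/\ forall (a : C) (u v w : V),
        ip (cscale a u + v) w = a * ip u w + ip v w,
      forall v w : V, ip w v = Num.conj (ip v w)
    & forall v : V, v != 0 -> 0 < ip v v].

Definition star_invariant (V : lmodType U) (ip : V -> V -> C) : Prop :=
  forall (X : U) (v w : V), ip (X *: v) w = ip v (star X *: w).

Definition unitarizable (V : lmodType U) : Prop :=
  exists ip : V -> V -> C, inner_product ip /\ star_invariant ip.

Definition K_eigenspace (V : lmodType U) (a : C) : set V :=
  [set v | gK q *: v = cscale a v].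
Arguments K_eigenspace : clear implicits.

Definition K_eigenvalues (V : lmodType U) : set C :=
  [set a | exists2 v, K_eigenspace V a v & v != 0].

(* Only the sum has to be required: eigenspaces of one operator for distinct
   eigenvalues are independent. *)
Definition admissible (V : lmodType U) : Prop :=
  (forall v : V, exists (n : nat) (a : 'I_n -> C) (w : 'I_n -> V),
      (forall j, K_eigenspace V (a j) (w j)) /\ v = \sum_(j < n) w j) /\
  (forall a : C, exists (n : nat) (b : 'I_n -> V),
      K_eigenspace V a `<=` cspan b).

Definition type_I (V : lmodType U) : Prop :=
  forall a, K_eigenvalues V a -> exists tau : R, a = (q `^ tau)%:C.

(* The carrier is the space of finite linear combinations of the orthonormal
   vectors [e i], [i : I], i.e. of the standard basis of l^2(I). *)
Record series_rep (I : eqType) (S : set C) (omega : C) (V : lmodType U) :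
    Prop := SeriesRep {
  series_irreducible : irreducible V;
  series_admissible : admissible V;
  series_type_I : type_I V;
  series_unitary : exists (ip : V -> V -> C) (e : I -> V),
    [/\ inner_product ip, star_invariant ip,
        forall i j, ip (e i) (e j) = (i == j)%:R
      & cspan e = setT];
  series_casimir : forall v : V, casimir q *: v = cscale omega v;
  series_eigenvalues : K_eigenvalues V = S;
  series_mult1 : forall a, S a ->
    exists w : V, forall v, K_eigenspace V a v -> exists c, v = cscale c w
}.

(* V is equivalent to "the" module satisfying P: such a module exists, and V is
   isomorphic to every module satisfying P, so that P determines its module up
   to isomorphism. *)
Definition equivalent_to (V : lmodType U) (P : lmodType U -> Prop) : Prop :=
  (exists W : lmodType U, P W) /\ forall W : lmodType U, P W -> isomorphic V W.

End UModules.

(** * Parameters of the series *)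

Section Series.
Variables (R : realType) (q : R).
Local Notation C := R[i].
Local Notation U := (Uq q).

(* q^z for complex z and q > 0 *)
Definition cpow (z : C) : C :=
  (expR (complex.Re z * ln q))%:C *
  Complex (cos (complex.Im z * ln q)) (sin (complex.Im z * ln q)).

Definition casimir_value (sigma : C) : C :=
  (cpow (2 * sigma + 1) + cpow (- 2 * sigma - 1)) / (q%:C^-1 - q%:C) ^+ 2.

Definition principal_parameters (sigma : C) (eps : R) : Prop :=
  [/\ exists b : R, 0 <= b <= - (pi / (2 * ln q)) /\
        sigma = Complex (- 2^-1) b,
      eps = 0 \/ eps = 2^-1
    & (sigma, eps) <> ((- 2^-1)%:C, 2^-1)].

Definition strange_parameters (sigma : C) (eps : R) : Prop :=
  (exists a : R, 0 < a /\
     sigma = Complex (- 2^-1 + a) (- (pi / (2 * ln q)))) /\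
  (eps = 0 \/ eps = 2^-1).

Definition complementary_parameters (sigma : C) (eps : R) : Prop :=
  (exists s : R, - 2^-1 < s < 0 /\ sigma = s%:C) /\ eps = 0.

(* The set q^(2 eps + 2 Z). *)
Definition q_lattice (eps : R) : set C :=
  [set (q `^ (2 * eps + 2 * m%:~R))%:C | m in [set: int]].

Definition lattice_series (sigma : C) (eps : R) : lmodType U -> Prop :=
  series_rep int (q_lattice eps) (casimir_value sigma).

Definition positive_discrete (k : R) : lmodType U -> Prop :=
  series_rep nat [set (q `^ (2 * k + 2 * m%:R))%:C | m in [set: nat]]
    (casimir_value (- k)%:C).

Definition negative_discrete (k : R) : lmodType U -> Prop :=
  series_rep nat [set (q `^ (- 2 * k - 2 * m%:R))%:C | m in [set: nat]]
    (casimir_value (- k)%:C).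

End Series.

(* Main.v *)
From HB Require Import structures.
From mathcomp Require Import all_boot all_order all_algebra complex.
From mathcomp Require Import all_classical all_reals all_analysis.
From mathcomp Require Import ring lra zify.
Require Import Defs.

Set Implicit Arguments.
Unset Strict Implicit.
Unset Printing Implicit Defensive.

Import Order.TTheory GRing.Theory Num.Theory.

Local Open Scope classical_set_scope.
Local Open Scope ring_scope.
Local Open Scope complex_scope.

(** All modules in question are chains of one-dimensional weight spaces for K.
    The Casimir element is central, so it acts on a module generated by a weight
    vector v0 by a scalar om, and then EF acts on the space of K-weight x by
    [om - casK x]. This scalar, called [mun n] on the n-th space of the chain,
    controls everything.

    The centralizer of K is generated by K, its inverse and EF ([U0_gen]), because
    q is not a root of unity. Hence a module receives a map from the induced
    module, with prescribed image of the generator, as soon as K and EF act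
    correctly on this image ([Mchi_universal]). Two consequences. A module of the
    series contains a vector of weight lambda, the Casimir value makes EF act on
    it by mu, and so it is the image of the induced module; once the latter, or
    the quotient through which the map factors, is irreducible, Schur's lemma
    gives the equivalence ([Mchi_equivalent], [quotient_equivalent]). And the
    induced module maps to a module of functions on the integers on which E and F
    are weighted shifts, which provides coordinates.

    If EF is negative on every link between occupied positions of the chain, the
    shift coefficients can be chosen so that the delta functions are orthonormal
    for an invariant inner product, and one can move along the chain in both
    directions, which gives irreducibility ([chain_series]). If [mun 0] or [mun 1]
    vanishes the chain breaks at this link and the quotient by one half is the
    discrete series ([positive_quotient], [negative_quotient]).

    For a Casimir value with numerator L, negativity says that L is less than
    [q^t + q^-t] for the exponents t = 2 eps + 2 m - 1. For the three continuous
    series this holds for all integers m ([series_sign]); for the discrete series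
    the two sides agree at the breaking link, and L is smaller on all links of
    the half that remains. *)

(** * Submodules, quotients and Schur's lemma *)

Section Submodules.
Variables (A : pzRingType) (V : lmodType A) (W : set V).
Hypothesis HW : is_submodule W.

Lemma submod0 : W 0. Proof. by case: HW. Qed.

Lemma submodD v w : W v -> W w -> W (v + w).
Proof. by move=> Wv Ww; rewrite -[v]scale1r; apply: HW.2. Qed.

Lemma submodZ a v : W v -> W (a *: v).
Proof. by move=> Wv; rewrite -[_ *: _]addr0; apply: HW.2; [|exact: submod0]. Qed.

Lemma submodB v w : W v -> W w -> W (v - w).
Proof. by move=> Wv Ww; rewrite -scaleN1r; apply/submodD/submodZ. Qed.

End Submodules.

Lemma ker_submodule (A : pzRingType) (V V' : lmodType A)
    (f : {linear V -> V'}) : is_submodule [set v | f v = 0].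
Proof.
by split=> [|a v w /= fv fw]; rewrite /= ?linear0 // linearP fv fw scaler0 addr0.
Qed.

Lemma im_submodule (A : pzRingType) (V V' : lmodType A)
    (f : {linear V -> V'}) : is_submodule (range f).
Proof.
split=> [|a _ _ [v _ <-] [w _ <-]]; first by exists 0; rewrite ?linear0.
by exists (a *: v + w); rewrite ?linearP.
Qed.

(** The kernel is a submodule that misses v0. *)
Lemma irreducible_inj (A : pzRingType) (V V' : lmodType A)
    (f : {linear V -> V'}) (v0 : V) :
  irreducible V -> f v0 != 0 -> injective f.
Proof.
move=> [_ irr] fv0.
have [k0|kT] := irr _ (ker_submodule f); last first.
  by case/eqP: fv0; have : [set v | f v = 0] v0 by rewrite kT.
move=> v w fvw; apply/eqP; rewrite -subr_eq0; apply/eqP.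
have : [set v | f v = 0] (v - w) by rewrite /= linearB fvw subrr.
by rewrite k0.
Qed.

Lemma Schur (A : pzRingType) (V V' : lmodType A)
    (f : {linear V -> V'}) (v0 : V) :
  irreducible V -> irreducible V' -> f v0 != 0 -> isomorphic V V'.
Proof.
move=> irrV [_ irrV'] fv0; exists f.
have f_inj := irreducible_inj irrV fv0.
have [i0|iT] := irrV' _ (im_submodule f).
  by case/eqP: fv0; have : range f (f v0) by [exists v0]; rewrite i0.
have f_surj w : exists v, f v = w.
  by have : range f w by [rewrite iT]; move=> [v _ <-]; exists v.
exists (fun w => projT1 (cid (f_surj w))) => [v|w].
  by apply: f_inj; case: cid.
by case: cid.
Qed.

Lemma linear_of (A : pzRingType) (V V' : lmodType A) (f : V -> V') :
  linear f -> exists g : {linear V -> V'}, g =1 f.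
Proof.
move=> lf; pose l := GRing.isLinear.Build A V V' _ f lf.
by exists (HB.pack f l : {linear V -> V'}).
Qed.

Lemma quotmod_pi_linear (A : pzRingType) (V : lmodType A) (W : set V)
  (HW : is_submodule W) : linear (quotmod_pi HW).
Proof.
by move=> a v w; rewrite -quotmod_addE -quotmod_scaleE.
Qed.

Lemma quotmod_lift (A : pzRingType) (V V' : lmodType A) (W : set V)
    (HW : is_submodule W) (f : {linear V -> V'}) :
  (forall v, W v -> f v = 0) ->
  exists g : {linear quotmod HW -> V'}, forall v, g (quotmod_pi HW v) = f v.
Proof.
move=> fW; pose h (x : quotmod HW) := f (repr x).
have hE v : h (quotmod_pi HW v) = f v.
  by apply/eqP; rewrite -subr_eq0 /h -linearB; apply/eqP/fW; exact: quotmod_repr.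
have h_lin : linear h.
  move=> a; elim/quotmod_ind=> v; elim/quotmod_ind=> w.
  by rewrite -quotmod_pi_linear !hE linearP.
by have [g gE] := linear_of h_lin; exists g => v; rewrite gE hE.
Qed.

(** * Complex scalars *)

Section CScale.
Variables (R : realType) (q : R).
Local Notation U := (Uq q).
Local Notation C := R[i].
Variable V : lmodType U.
Implicit Types (v w : V) (a b : C).

Lemma cscaleA a b v : cscale a (cscale b v) = cscale (a * b) v.
Proof. by rewrite /cscale scalerA -scalerAl mul1r scalerA. Qed.

Lemma cscale1 v : cscale 1 v = v.
Proof. by rewrite /cscale !scale1r. Qed.

Lemma cscale0 v : cscale 0 v = 0.
Proof. by rewrite /cscale !scale0r. Qed.

Lemma cscaler0 a : cscale a (0 : V) = 0.
Proof. by rewrite /cscale scaler0. Qed.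

Lemma cscaleDr a v w : cscale a (v + w) = cscale a v + cscale a w.
Proof. by rewrite /cscale scalerDr. Qed.

Lemma cscaleDl a b v : cscale (a + b) v = cscale a v + cscale b v.
Proof. by rewrite /cscale !scalerDl. Qed.

Lemma cscaleN a v : cscale a (- v) = - cscale a v.
Proof. by rewrite /cscale scalerN. Qed.

Lemma cscaleNl a v : cscale (- a) v = - cscale a v.
Proof. by rewrite /cscale !scaleNr. Qed.

Lemma cscaleBl a b v : cscale (a - b) v = cscale a v - cscale b v.
Proof. by rewrite cscaleDl cscaleNl. Qed.

Lemma scale_cscale (x : U) a v : x *: cscale a v = cscale a (x *: v).
Proof. by rewrite /cscale !scalerA -scalerAr mulr1 -scalerAl mul1r. Qed.

Lemma scale_algE (x : U) a v : (a *: x) *: v = cscale a (x *: v).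
Proof. by rewrite /cscale scalerA -scalerAl mul1r. Qed.

Lemma cscale_sumr a (J : Type) (r : seq J) (P : pred J) (F : J -> V) :
  cscale a (\sum_(j <- r | P j) F j) = \sum_(j <- r | P j) cscale a (F j).
Proof. by rewrite /cscale scaler_sumr. Qed.

Lemma cscale_suml (J : Type) (r : seq J) (P : pred J) (c : J -> C) v :
  cscale (\sum_(j <- r | P j) c j) v = \sum_(j <- r | P j) cscale (c j) v.
Proof. by rewrite /cscale !scaler_suml. Qed.

Lemma linear_cscale (V' : lmodType U) (f : {linear V -> V'}) a v :
  f (cscale a v) = cscale a (f v).
Proof. by rewrite /cscale linearZ. Qed.

(** ** Linear spans *)

Lemma cspan_gen (I : Type) (f : I -> V) i : cspan f (f i).
Proof.
exists 1%N, (fun=> i), (fun=> 1).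
by rewrite big_ord_recl big_ord0 addr0 cscale1.
Qed.

Lemma cspan0 (I : Type) (f : I -> V) : cspan f 0.
Proof.
exists 0%N.
by exists (fun j : 'I_0 => match j with Ordinal m h => match notF h with end end),
  (fun=> 0); rewrite big_ord0.
Qed.

Lemma cspanD (I : Type) (f : I -> V) v w :
  cspan f v -> cspan f w -> cspan f (v + w).
Proof.
move=> [m [i [c ->]]] [n [j [d ->]]]; exists (m + n)%N.
exists (fun k : 'I_(m + n) =>
  match fintype.split k with inl k => i k | inr k => j k end).
exists (fun k : 'I_(m + n) =>
  match fintype.split k with inl k => c k | inr k => d k end).
rewrite big_split_ord /=; congr (_ + _); apply: eq_bigr => k _.
  by rewrite (unsplitK (inl k)).
by rewrite (unsplitK (inr k)).
Qed.

Lemma cspan_cscale (I : Type) (f : I -> V) a v :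
  cspan f v -> cspan f (cscale a v).
Proof.
move=> [m [i [c ->]]]; exists m, i, (fun j => a * c j).
by rewrite cscale_sumr; apply: eq_bigr => j _; rewrite cscaleA.
Qed.

Lemma cspan_sub (I : Type) (f : I -> V) (P : set V) :
  P 0 -> (forall v w, P v -> P w -> P (v + w)) ->
  (forall a v, P v -> P (cscale a v)) -> (forall i, P (f i)) ->
  cspan f `<=` P.
Proof.
move=> P0 PD PZ Pf _ [m [i [c ->]]].
by elim/big_ind: _ => // j _; apply: PZ.
Qed.

(** Repetitions in a linear combination can be collected. *)
Lemma cspan_uniq (I : choiceType) (f : I -> V) v : cspan f v ->
  exists (s : seq I) (c : I -> C), uniq s /\ v = \sum_(i <- s) cscale (c i) (f i).
Proof.
move=> [m [i [c ->]]]; pose s := undup [seq i j | j <- enum 'I_m].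
exists s, (fun k => \sum_(j < m | i j == k) c j); split; first exact: undup_uniq.
under [RHS]eq_bigr do rewrite cscale_suml.
rewrite (exchange_big_dep predT) //=; apply: eq_bigr => j _.
have ijs : i j \in s by rewrite mem_undup map_f // mem_enum.
under eq_bigl => k do rewrite eq_sym.
by rewrite -big_filter (filter_pred1_uniq (undup_uniq _) ijs) big_seq1.
Qed.

End CScale.

(** * Spectral decomposition *)

(** For an operator T and a sum of eigenvectors, a product of factors [T - b]
    isolates the part of the sum with one given eigenvalue, up to a nonzero
    factor. The operator
    is additive and complex linear, so that it can be the action of
    K on a module as well as conjugation by K on the algebra. *)
Section Spectral.
Variables (R : realType) (q : R).
Local Notation U := (Uq q).
Local Notation C := R[i].
Variables (V : lmodType U) (T : V -> V).
Hypothesis TD : forall v w, T (v + w) = T v + T w.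
Hypothesis TZ : forall a v, T (cscale a v) = cscale a (T v).

(** The operator [\prod_(b <- bs) (T - b)]. *)
Fixpoint spectral_prod (bs : seq C) (v : V) : V :=
  if bs is b :: bs then T (spectral_prod bs v) - cscale b (spectral_prod bs v)
  else v.

Let T0 : T 0 = 0.
Proof. by rewrite -(cscale0 0) TZ !cscale0. Qed.

Lemma spectral_prodD bs v w :
  spectral_prod bs (v + w) = spectral_prod bs v + spectral_prod bs w.
Proof.
by elim: bs => //= b bs ->; rewrite TD cscaleDr opprD addrACA.
Qed.

Lemma spectral_prod0 bs : spectral_prod bs 0 = 0.
Proof. by elim: bs => //= b bs ->; rewrite T0 cscaler0 subrr. Qed.

Lemma spectral_prod_eigen bs a v : T v = cscale a v ->
  spectral_prod bs v = cscale (\prod_(b <- bs) (a - b)) v.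
Proof.
move=> Tv; elim: bs => [|b bs /= ->]; first by rewrite big_nil cscale1.
by rewrite big_cons TZ Tv !cscaleA -cscaleBl mulrC -mulrBl.
Qed.

Section Sum.
Variables (J : eqType) (s : seq J) (a : J -> C) (x : J -> V).
Hypothesis Tx : forall j, T (x j) = cscale (a j) (x j).
Variable alpha : C.

(* The eigenvalues in the sum that have to be cancelled. *)
Let bs := [seq a j | j <- s & a j != alpha].

Let bs_neq0 : \prod_(b <- bs) (alpha - b) != 0.
Proof.
rewrite prodf_seq_neq0; apply/allP => b /mapP[j].
by rewrite mem_filter => /andP[aj _] ->; rewrite subr_eq0 eq_sym.
Qed.

Let prod_sum : spectral_prod bs (\sum_(j <- s) x j) =
  cscale (\prod_(b <- bs) (alpha - b)) (\sum_(j <- s | a j == alpha) x j).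
Proof.
rewrite (big_morph _ (spectral_prodD bs) (spectral_prod0 bs)).
rewrite (bigID (fun j => a j == alpha)) /= [X in _ + X]big1_seq ?addr0.
  rewrite cscale_sumr; apply: eq_bigr => j /eqP aj.
  by rewrite (spectral_prod_eigen _ (Tx j)) aj.
move=> j /andP[aj js]; rewrite (spectral_prod_eigen _ (Tx j)).
suff /eqP -> : \prod_(b <- bs) (a j - b) == 0 by rewrite cscale0.
rewrite prodf_seq_eq0; apply/hasP; exists (a j); last by rewrite /= subrr.
by apply/mapP; exists j; rewrite // mem_filter aj.
Qed.

(** A subspace stable under T contains the alpha-part of each of its vectors. *)
Lemma spectral_component (W : set V) :
    (forall v w, W v -> W w -> W (v - w)) ->
    (forall c v, W v -> W (cscale c v)) -> (forall v, W v -> W (T v)) ->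
  W (\sum_(j <- s) x j) -> W (\sum_(j <- s | a j == alpha) x j).
Proof.
move=> WB WZ WT Wx.
have Wprod bs' v : W v -> W (spectral_prod bs' v).
  by move=> Wv; elim: bs' => //= b bs' IH; apply: WB; [exact: WT|exact: WZ].
have := WZ (\prod_(b <- bs) (alpha - b))^-1 _ (Wprod bs _ Wx).
by rewrite prod_sum cscaleA mulVf // cscale1.
Qed.

(** Only the terms with eigenvalue alpha contribute to an eigenvector for alpha. *)
Lemma spectral_eigen (v : V) : T v = cscale alpha v ->
  v = \sum_(j <- s) x j -> v = \sum_(j <- s | a j == alpha) x j.
Proof.
move=> Tv vE; have := prod_sum; rewrite -vE (spectral_prod_eigen _ Tv).
move=> /(congr1 (cscale (\prod_(b <- bs) (alpha - b))^-1)).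
by rewrite !cscaleA mulVf // !cscale1.
Qed.

End Sum.
End Spectral.

(** * The centralizer of K *)

Section QNonzero.
Variables (R : realType) (q : R).
Hypotheses (q0 : 0 < q) (q1 : q < 1).
Local Notation cq := (q%:C).

Lemma qC_neq0 : cq != 0.
Proof. by rewrite (inj_eq (@complexI R)) gt_eqF. Qed.

Lemma qC_exp_eq1 (n : nat) : cq ^+ n = 1 -> n = 0%N.
Proof.
rewrite -rmorphXn -(rmorph1 (real_complex R)) => /complexI /eqP.
by rewrite pexprn_eq1 ?ltW // (lt_eqF q1) orbF => /eqP.
Qed.

Lemma qC_sub_neq0 : cq - cq^-1 != 0.
Proof.
apply/eqP => /eqP; rewrite subr_eq0 => /eqP E.
by have /qC_exp_eq1 : cq ^+ 2 = 1 by rewrite expr2 {2}E mulfV // qC_neq0.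
Qed.

End QNonzero.

Section Centralizer.
Variables (R : realType) (q : R).
Hypotheses (q0 : 0 < q) (q1 : q < 1).
Local Notation U := (Uq q).
Local Notation C := R[i].
Local Notation cq := (q%:C).
Local Notation E := (gE q).
Local Notation F := (gF q).
Local Notation K := (gK q).
Local Notation KV := (gKV q).

Let cq0 := qC_neq0 q0.

(** Induction on noncommutative polynomials in the generators. *)
Lemma Uq_ind (P : U -> Prop) :
  (forall a, P a%:A) -> P E -> P F -> P K -> P KV ->
  (forall x y, P x -> P y -> P (x + y)) ->
  (forall x y, P x -> P y -> P (x * y)) -> forall x, P x.
Proof.
move=> PC PE PF PK PKV PD PM; elim/upi_ind; elim => // [a|x Px y Py|x Px y Py].
- by rewrite (_ : upi q (UC a) = a%:A) // [RHS]upiZ; apply/upiP/Ur_sym/Ur_mul1r.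
- by rewrite -upiD; apply: PD.
- by rewrite -upiM; apply: PM.
Qed.

Lemma gKFV : KV * F = cq ^+ 2 *: (F * KV).
Proof.
rewrite -[LHS]mulr1 -(gKKV q) mulrA -(mulrA KV) gFK ?gt_eqF // -scalerAr -scalerAl.
by rewrite mulrA gKVK mul1r.
Qed.

Lemma gFE : F * E = E * F - (cq - cq^-1)^-1 *: (K - KV).
Proof. by rewrite -gEF opprB addrC subrK. Qed.

(** The subalgebra generated by K, its inverse and EF. *)
Inductive U0gen : U -> Prop :=
  | U0gen_C a : U0gen a%:A
  | U0gen_K : U0gen K
  | U0gen_KV : U0gen KV
  | U0gen_EF : U0gen (E * F)
  | U0gen_D x y : U0gen x -> U0gen y -> U0gen (x + y)
  | U0gen_M x y : U0gen x -> U0gen y -> U0gen (x * y).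

Lemma U0gen_Z a x : U0gen x -> U0gen (a *: x).
Proof. by move=> gx; rewrite -[x]mul1r scalerAl; exact/U0gen_M/gx/U0gen_C. Qed.

Lemma U0gen_B x y : U0gen x -> U0gen y -> U0gen (x - y).
Proof. by move=> gx gy; rewrite -scaleN1r; exact/U0gen_D/U0gen_Z. Qed.

Lemma U0gen_FE : U0gen (F * E).
Proof.
by rewrite gFE; do !(apply: U0gen_B || apply: U0gen_Z || constructor).
Qed.

Lemma U0gen_U0 x : U0gen x -> U0_pred x.
Proof.
elim=> [a||||y z _ /eqP yK _ /eqP zK|y z _ /eqP yK _ /eqP zK]; apply/eqP.
- by rewrite -scalerAl -scalerAr mul1r mulr1.
- by [].
- by rewrite gKVK gKKV.
- by rewrite gKEF.
- by rewrite mulrDl mulrDr yK zK.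
- by rewrite -mulrA zK mulrA yK mulrA.
Qed.

Local Notation G b := (if b : bool then E else F).

(** Moving E or F to the left preserves this subalgebra, as K and its inverse
    q-commute with E and F while EF becomes FE or is corrected by the
    commutator. *)
Lemma U0gen_comm x (b : bool) : U0gen x -> exists2 y, U0gen y & x * G b = G b * y.
Proof.
elim=> [a||||x1 x2 _ [y1 g1 e1] _ [y2 g2 e2]|x1 x2 _ [y1 g1 e1] _ [y2 g2 e2]].
- by exists a%:A; [constructor | rewrite -scalerAl -scalerAr mul1r mulr1].
- exists ((if b then cq ^+ 2 else cq ^- 2) *: K).
    by apply: U0gen_Z; constructor.
  by case: b; rewrite -scalerAr ?gKE ?gKF.
- exists ((if b then cq ^- 2 else cq ^+ 2) *: KV).
    by apply: U0gen_Z; constructor.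
  by case: b; rewrite -scalerAr ?gKVE ?gKFV // gt_eqF.
- case: b; first by exists (F * E); rewrite ?mulrA //; exact: U0gen_FE.
  exists (E * F + (cq - cq^-1)^-1 *: (cq ^- 2 *: K - cq ^+ 2 *: KV)).
    by do !(apply: U0gen_D || apply: U0gen_B || apply: U0gen_Z || constructor).
  have {1}-> : E * F = F * E + (cq - cq^-1)^-1 *: (K - KV).
    by rewrite gFE subrK.
  by rewrite mulrDl -scalerAl mulrBl gKF gKFV mulrDr -scalerAr mulrBr -!scalerAr mulrA.
- by exists (y1 + y2); [constructor | rewrite mulrDl mulrDr e1 e2].
- exists (y1 * y2); first by constructor.
  by rewrite -mulrA e2 mulrA e1 mulrA.
Qed.

Lemma U0gen_commX x (b : bool) m : U0gen x ->
  exists2 y, U0gen y & x * G b ^+ m = G b ^+ m * y.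
Proof.
move=> gx; elim: m => [|m [y gy yE]].
  by exists x; rewrite ?expr0 ?mulr1 ?mul1r.
have [z gz zE] := U0gen_comm b gy.
by exists z => //; rewrite exprSr mulrA yE -mulrA zE mulrA.
Qed.

(** These elements are weight vectors for [x |-> K x K^-1] and span U. *)
Definition homog (p : bool * nat * U) : U := G p.1.1 ^+ p.1.2 * p.2.

Definition decomposable (x : U) :=
  exists s : seq (bool * nat * U),
    (forall p, p \in s -> U0gen p.2) /\ x = \sum_(p <- s) homog p.

Lemma decomposable0 : decomposable 0.
Proof. by exists [::]; rewrite big_nil. Qed.

Lemma decomposableD x y : decomposable x -> decomposable y ->
  decomposable (x + y).
Proof.
move=> [s [gs ->]] [t [gt ->]]; exists (s ++ t); rewrite big_cat; split=> // p.
by rewrite mem_cat => /orP[/gs|/gt].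
Qed.

Lemma decomposable_homog b m x : U0gen x -> decomposable (G b ^+ m * x).
Proof.
move=> gx; exists [:: (b, m, x)]; rewrite big_seq1; split=> // p.
by rewrite inE => /eqP ->.
Qed.

Lemma decomposable_mul (g : U) :
    (forall b m x, U0gen x -> decomposable (g * (G b ^+ m * x))) ->
  forall x, decomposable x -> decomposable (g * x).
Proof.
move=> gP _ [s [gs ->]]; rewrite big_distrr /=.
rewrite big_seq; elim/big_ind: _ => [||[[b m] x] /gs]; last exact: gP.
  exact: decomposable0.
exact: decomposableD.
Qed.

Lemma decomposable_mulU0 y : U0gen y ->
  forall x, decomposable x -> decomposable (y * x).
Proof.
move=> gy; apply: decomposable_mul => b m x gx.
have [z gz zE] := U0gen_commX b m gy.
by rewrite mulrA zE -mulrA; apply: decomposable_homog; constructor.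
Qed.

(** The sums of homogeneous elements form a left ideal containing 1: a product EF
    or FE arising from multiplication by E or F is absorbed in the centralizer. *)
Lemma decomposable_all x : decomposable x.
Proof.
suff main g y : decomposable y -> decomposable (g * y).
  rewrite -[x]mulr1; apply: main.
  have U0gen1 : U0gen 1 by rewrite -[1]scale1r; constructor.
  by have := decomposable_homog true 0 U0gen1; rewrite expr0 mulr1.
elim/Uq_ind: g y => [a|||||s t IHs IHt|s t IHs IHt] y.
- by apply: decomposable_mulU0; constructor.
- apply: decomposable_mul => b m z gz; rewrite mulrA.
  case: b; first by rewrite -exprS; exact: (decomposable_homog true).
  case: m => [|m].
    by rewrite expr0 mulr1 -[E]expr1; exact: (decomposable_homog true).
  rewrite exprS mulrA -mulrA.
  by apply: decomposable_mulU0; [constructor|exact: (decomposable_homog false)].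
- apply: decomposable_mul => b m z gz; rewrite mulrA.
  case: b; last by rewrite -exprS; exact: (decomposable_homog false).
  case: m => [|m].
    by rewrite expr0 mulr1 -[F]expr1; exact: (decomposable_homog false).
  rewrite exprS mulrA -mulrA.
  apply: decomposable_mulU0; [exact: U0gen_FE|exact: (decomposable_homog true)].
- by apply: decomposable_mulU0; constructor.
- by apply: decomposable_mulU0; constructor.
- by move=> yS; rewrite mulrDl; apply: decomposableD; auto.
- by move=> yS; rewrite -mulrA; auto.
Qed.

Lemma cscale_regular a (x : U^o) : cscale a x = a *: (x : U).
Proof. by rewrite -mulr_algl. Qed.

Let conjK (x : U^o) : U^o := K * x * KV.

Let wt (p : bool * nat * U) : C := (if p.1.1 then cq ^+ 2 else cq ^- 2) ^+ p.1.2.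

Let conjK_homog p : U0gen p.2 -> conjK (homog p) = wt p *: homog p.
Proof.
case: p => [[b m] x] /= /U0gen_U0 /eqP xK; rewrite /conjK /homog /wt /=.
have KG : K * G b = (if b then cq ^+ 2 else cq ^- 2) *: (G b * K).
  by case: b; rewrite ?gKE ?gKF.
move: KG; set g := G b; set c := (if b then _ else _) => KG.
have KGm : K * g ^+ m = c ^+ m *: (g ^+ m * K).
  elim: m => [|m IH]; first by rewrite !expr0 scale1r mulr1 mul1r.
  rewrite [in LHS]exprS mulrA KG -scalerAl -mulrA IH -scalerAr scalerA -exprS.
  by rewrite mulrA -exprS.
rewrite mulrA KGm -scalerAl -mulrA -xK mulrA -scalerAl -mulrA gKKV mulr1.
by [].
Qed.

Let wt_eq1 p : wt p = 1 -> p.1.2 = 0%N.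
Proof.
rewrite /wt; case: p => [[[] m] x] /=; rewrite ?exprVn -exprM.
  by move=> /(qC_exp_eq1 q0 q1) /eqP; rewrite muln_eq0 => /eqP.
move=> /(congr1 (fun x => x^-1)); rewrite invrK invr1.
by move=> /(qC_exp_eq1 q0 q1) /eqP; rewrite muln_eq0 => /eqP.
Qed.

(** The centralizer of K consists of the vectors of weight 1 for conjugation by
    K. As q is not a root of unity, only the homogeneous elements without powers
    of E or F in front have this weight. *)
Lemma U0_gen x : U0_pred x -> U0gen x.
Proof.
move=> /eqP xK; have [s [gs xE]] := decomposable_all x.
have conjKD (y z : U^o) : conjK (y + z) = conjK y + conjK z.
  by rewrite /conjK mulrDr mulrDl.
have conjKZ a (y : U^o) : conjK (cscale a y) = cscale a (conjK y).
  by rewrite !cscale_regular /conjK -scalerAr -scalerAl.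
pose y p : U^o := if `[< U0gen p.2 >] then homog p else 0.
have conjKy p : conjK (y p) = cscale (wt p) (y p).
  rewrite /y; case: asboolP => [gp|_].
    by rewrite conjK_homog // cscale_regular.
  by rewrite /conjK mulr0 mul0r cscaler0.
have xy : x = \sum_(p <- s) y p :> U^o.
  rewrite xE [LHS]big_seq [RHS]big_seq; apply: eq_bigr => p /gs gp.
  by rewrite /y asboolT.
have Tx : conjK x = cscale 1 (x : U^o).
  by rewrite cscale1 /conjK -xK -mulrA gKKV mulr1.
rewrite (spectral_eigen conjKD conjKZ conjKy Tx xy).
have U0gen0 : U0gen 0 by rewrite -(scale0r 1); constructor.
elim/big_ind: _ => // [u v|p /eqP /wt_eq1 p0]; first exact: U0gen_D.
by rewrite /y; case: asboolP => // gp; rewrite /homog p0 expr0 mul1r.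
Qed.

End Centralizer.

(** * Modules generated by a weight vector *)

Section Universal.
Variables (R : realType) (q : R) (lam mu : R[i]).
Hypotheses (q0 : 0 < q) (q1 : q < 1).
Variables (chi : U0_char q lam mu).
Local Notation U := (Uq q).
Local Notation C := R[i].

Let KV0 : U0 q := exist _ (gKV q) (U0gen_U0 (U0gen_KV q)).

Lemma U0_char_KV : (chi KV0 : C) * lam = 1.
Proof.
have <- : chi (KV0 * U0K q) = chi KV0 * lam.
  by rewrite rmorphM; congr (_ * _); exact: U0_charK.
by rewrite -(rmorph1 chi); congr (chi _); apply: val_inj; exact: gKVK.
Qed.

Lemma U0_char_alg a : chi a%:A = a.
Proof. by rewrite linearZ rmorph1; exact: mulr1. Qed.

Lemma U0_char_neq0 : lam != 0.
Proof.
have [l0|//] := eqVneq lam 0; have := U0_char_KV.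
by rewrite [X in _ * X]l0 mulr0 => /eqP; rewrite eq_sym oner_eq0.
Qed.

Section Vector.
Variables (V : lmodType U) (v0 : V).
Hypotheses (Kv0 : gK q *: v0 = cscale lam v0)
           (EFv0 : (gE q * gF q) *: v0 = cscale mu v0).

(** A character of the centralizer of K is determined by its values at K and
    EF, since these generate. *)
Lemma U0_act (u : U0 q) : val u *: v0 = cscale (chi u) v0.
Proof.
have lam0 := U0_char_neq0.
suff main x : U0gen x -> exists2 y : U0 q, val y = x & x *: v0 = cscale (chi y) v0.
  by have [y /val_inj -> ] := main _ (U0_gen q0 q1 (valP u)).
elim=> [a||||x1 x2 _ [y1 e1 E1] _ [y2 e2 E2]|x1 x2 _ [y1 e1 E1] _ [y2 e2 E2]].
- by exists a%:A => //; rewrite U0_char_alg.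
- by exists (U0K q) => //; rewrite U0_charK.
- exists KV0 => //.
  have -> : chi KV0 = lam^-1 by apply: (mulIf lam0); rewrite mulVf //; exact: U0_char_KV.
  have {1}-> : v0 = cscale lam^-1 (gK q *: v0).
    by rewrite Kv0 cscaleA mulVf // cscale1.
  by rewrite scale_cscale scalerA gKVK scale1r.
- by exists (U0EF q) => //; rewrite U0_charEF.
- by exists (y1 + y2); rewrite ?rmorphD /= ?e1 ?e2 // scalerDl E1 E2 cscaleDl.
- exists (y1 * y2); first by rewrite /= e1 e2.
  by rewrite -scalerA E2 scale_cscale E1 cscaleA rmorphM mulrC.
Qed.

(** The map [a (x) z |-> a z v0], on representatives of tensors. *)
Fixpoint tensor_eval (t : tensor_term (Uq q) (line chi)) : V :=
  match t with
  | TPure a z => a *: cscale (z : C) v0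
  | TZero => 0
  | TOpp s => - tensor_eval s
  | TAdd s u => tensor_eval s + tensor_eval u
  end.

Lemma tensor_eval_cong s t :
  tensor_cong (\val : {rmorphism U0 q -> Uq q}) s t ->
  tensor_eval s = tensor_eval t.
Proof.
elim=> //=; try by move=> *; congruence.
- by move=> *; rewrite addrA.
- by move=> *; rewrite addrC.
- by move=> *; rewrite add0r.
- by move=> *; rewrite addNr.
- by move=> *; rewrite scalerDl.
- by move=> *; rewrite cscaleDl scalerDr.
- move=> a b z; rewrite -scalerA scale_cscale U0_act cscaleA; congr (_ *: cscale _ _).
  by rewrite mulrC.
Qed.

(** Frobenius reciprocity for the induced module: it maps to every module with a
    vector on which K and EF act as on the inducing line. *)
Lemma Mchi_universal : exists f : {linear Mchi chi -> V}, f (Mchi1 chi) = v0.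
Proof.
pose h (x : Mchi chi) := tensor_eval (repr x).
have hE t : h (tensor_pi _ t) = tensor_eval t.
  by apply: tensor_eval_cong; apply: tensor_repr.
have h_lin : linear h.
  move=> a; elim/tensor_ind=> s; elim/tensor_ind=> t.
  rewrite [a *: _]tensor_scaleE [_ + _]tensor_addE !hE /=; congr (_ + _).
  elim: s => [b z||s IH|s IHs u IHu] /=.
  - by rewrite -scalerA.
  - by rewrite scaler0.
  - by rewrite IH scalerN.
  - by rewrite IHs IHu scalerDr.
by have [g gE] := linear_of h_lin; exists g; rewrite gE hE /= scale1r cscale1.
Qed.

End Vector.

Lemma Mchi1_gen (v : Mchi chi) : exists x : U, v = x *: Mchi1 chi.
Proof.
elim/tensor_ind: v; elim=> [a z||s [x IH]|s [x IHs] t [y IHt]].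
- exists (z *: a); rewrite [RHS]tensor_scaleE /= mulr1; apply/tensor_piP.
  have -> : z *: a = a * \val (z%:A : U0 q) by rewrite /= -scalerAr mulr1.
  apply: TC_sym; apply: TC_trans (TC_balanced _ _ _ _) _.
  rewrite (_ : z%:A *: (1 : line chi) = z); first exact: TC_refl.
  by rewrite /GRing.scale /= /line_scale mulr1 U0_char_alg.
- by exists 0; rewrite scale0r.
- exists (- x); rewrite scaleNr -IH; exact/esym/tensor_oppE.
- exists (x + y); rewrite scalerDl -IHs -IHt; exact/esym/tensor_addE.
Qed.

Lemma Mchi1_act (u : U0 q) : val u *: Mchi1 chi = cscale (chi u) (Mchi1 chi).
Proof.
have pureE (x : U0 q) : val x *: Mchi1 chi =
    tensor_pi _ (TPure 1 ((chi x : C) : line chi)).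
  rewrite [LHS]tensor_scaleE /= mulr1; apply/tensor_piP.
  apply: TC_trans (TC_trans (TC_balanced _ 1 x _) _).
    by rewrite mul1r; apply: TC_refl.
  by rewrite /GRing.scale /= /line_scale mulr1; apply: TC_refl.
rewrite pureE /cscale (_ : (chi u)%:A = val ((chi u)%:A : U0 q)) // pureE.
by rewrite U0_char_alg.
Qed.

Lemma Mchi1_K : gK q *: Mchi1 chi = cscale lam (Mchi1 chi).
Proof. by rewrite -[X in cscale X _](U0_charK chi) -Mchi1_act. Qed.

Lemma Mchi1_EF : (gE q * gF q) *: Mchi1 chi = cscale mu (Mchi1 chi).
Proof. by rewrite -[X in cscale X _](U0_charEF chi) -Mchi1_act. Qed.

End Universal.

(** * The Casimir element and weight vectors *)

Section Casimir.
Variables (R : realType) (q : R).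
Hypotheses (q0 : 0 < q) (q1 : q < 1).
Local Notation U := (Uq q).
Local Notation C := R[i].
Local Notation cq := (q%:C).
Local Notation E := (gE q).
Local Notation F := (gF q).
Local Notation K := (gK q).
Local Notation KV := (gKV q).
Local Notation Om := (casimir q).

Let cq0 := qC_neq0 q0.
Let cq2 := qC_sub_neq0 q0 q1.

(** For E and F the commutator of EF cancels that of the K-part. Commutation
    with the inverse of K follows from commutation with K. *)
Lemma casimir_central x : Om * x = x * Om.
Proof.
have OmK : Om * K = K * Om.
  rewrite /casimir mulrDl mulrDr gKEF; congr (_ + _).
  by rewrite -scalerAl -scalerAr mulrDl mulrDr -!scalerAl -!scalerAr gKKV gKVK.
have cq21 : cq ^+ 2 - 1 != 0.
  have -> : cq ^+ 2 - 1 = cq * (cq - cq^-1) by rewrite mulrBr mulfV // expr2.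
  by rewrite mulf_neq0.
elim/Uq_ind: x => [a||||| x y ex ey|x y ex ey].
- by rewrite -scalerAl -scalerAr mul1r mulr1.
- rewrite /casimir mulrDl mulrDr -mulrA gFE mulrBr -addrA; congr (_ + _).
  rewrite -!scalerAr -!scalerAl !mulrDr !mulrDl -!scalerAl gKE gKVE ?gt_eqF //.
  rewrite mulrN -!scalerAr !scalerA !(scalerBr, scalerDr) !scalerA opprB.
  rewrite addrC [X in _ + X]addrC addrACA -scalerBl -scalerDl.
  by congr (_ *: _ + _ *: _); field; rewrite cq0 cq21.
- rewrite /casimir mulrDl mulrDr [in RHS]mulrA gFE mulrBl -addrA; congr (_ + _).
  rewrite -!scalerAr -!scalerAl !mulrDr !mulrDl -!scalerAl gKF gKFV //.
  rewrite -!scalerAr !(scalerDr, scalerA) opprD -!scaleNr addrACA -!scalerDl.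
  by congr (_ *: _ + _ *: _); field; rewrite cq0 cq21.
- by [].
- rewrite -[LHS]mul1r -(gKVK q) -[in LHS]mulrA [K * (_ * _)]mulrA -OmK.
  by rewrite -(mulrA Om) gKKV mulr1.
- by rewrite mulrDr [RHS]mulrDl ex ey.
- by rewrite mulrA ex -mulrA ey mulrA.
Qed.

End Casimir.

Lemma span_submodule (R : realType) (q : R) (V : lmodType (Uq q)) (I : Type)
    (f : I -> V) :
  (forall i, [/\ cspan f (gE q *: f i), cspan f (gF q *: f i),
                 cspan f (gK q *: f i) & cspan f (gKV q *: f i)]) ->
  is_submodule (cspan f).
Proof.
move=> fP; split; first exact: cspan0.
move=> x v w fv fw; apply: cspanD => //; move: x v fv {w fw}.
have gen x : (forall i, cspan f (x *: f i)) -> forall v, cspan f v -> cspan f (x *: v).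
  move=> xf; apply: cspan_sub => [|v w fv fw|a v fv|//].
  - by rewrite scaler0; apply: cspan0.
  - by rewrite scalerDr; apply: cspanD.
  - by rewrite scale_cscale; apply: cspan_cscale.
elim/Uq_ind => [a v|||||x y IHx IHy v fv|x y IHx IHy v fv].
- exact: cspan_cscale.
- by apply: gen => i; case: (fP i).
- by apply: gen => i; case: (fP i).
- by apply: gen => i; case: (fP i).
- by apply: gen => i; case: (fP i).
- by rewrite scalerDl; apply: cspanD; [exact: IHx|exact: IHy].
- by rewrite -scalerA; apply/IHx/IHy.
Qed.

Section WeightVectors.
Variables (R : realType) (q : R).
Hypotheses (q0 : 0 < q) (q1 : q < 1).
Local Notation U := (Uq q).
Local Notation C := R[i].
Local Notation cq := (q%:C).
Local Notation E := (gE q).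
Local Notation F := (gF q).
Local Notation K := (gK q).
Local Notation KV := (gKV q).

Let cq0 := qC_neq0 q0.
Let cq2 := qC_sub_neq0 q0 q1.

(** The Casimir element acts on a vector v of K-weight x as EF + casK x. *)
Definition casK (x : C) : C := (cq^-1 * x + cq * x^-1) / (cq - cq^-1) ^+ 2.

Variables (lam om : C).
Hypothesis lam0 : lam != 0.

(** K-weights and EF-eigenvalues along the chain of weight spaces through a
    vector of weight lam on which the Casimir element acts as om. *)
Definition wt (n : int) : C := lam * cq ^ (n * 2).
Definition mun (n : int) : C := om - casK (wt n).

Lemma wt_neq0 n : wt n != 0.
Proof. by rewrite mulf_neq0 // expfz_neq0. Qed.

Lemma wtS n : wt (n + 1) = cq ^+ 2 * wt n.
Proof. by rewrite /wt mulrDl mul1r expfzDr // [LHS]mulrA [LHS]mulrC. Qed.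

Lemma wt0 : wt 0 = lam.
Proof. by rewrite /wt mul0r expr0z mulr1. Qed.

Lemma wt_inj : injective wt.
Proof.
move=> m n /(mulfI lam0); rewrite -!fmorphXz => /complexI /ieexprIz -/(_ q0).
by rewrite lt_eqF // => /(_ isT) /(mulIf (_ : 2 != 0 :> int)) ->.
Qed.

(** Both sides are the eigenvalue of FE on the weight space number n. *)
Lemma munS n : mun n - (cq - cq^-1)^-1 * (wt n - (wt n)^-1) = mun (n + 1).
Proof.
rewrite /mun /casK wtS; field.
rewrite cq0 wt_neq0 /= (_ : _ - 1 = cq * (cq - cq^-1)) ?mulf_neq0 //.
by rewrite mulrBr mulfV.
Qed.

Variables (V : lmodType U) (v0 : V).
Hypotheses (Kv0 : K *: v0 = cscale lam v0) (Omv0 : casimir q *: v0 = cscale om v0).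

(** The chain through v0: powers of E to the right of 0, powers of F to its
    left. *)
Definition wvec (n : int) : V :=
  match n with Posz m => E ^+ m *: v0 | Negz m => F ^+ m.+1 *: v0 end.

Lemma E_wvec (n : nat) : E *: wvec n = wvec n.+1.
Proof. by rewrite /= scalerA -exprS. Qed.

Lemma F_wvec (n : nat) : F *: wvec (- n%:Z) = wvec (- n.+1%:Z).
Proof. by case: n => [|n] /=; rewrite ?expr1 ?scale1r // scalerA -exprS. Qed.

Lemma K_wvec n : K *: wvec n = cscale (wt n) (wvec n).
Proof.
elim: n => [|n IH|n IH]; first by rewrite wt0 /= expr0 scale1r.
- rewrite -E_wvec scalerA gKE scale_algE -scalerA IH scale_cscale cscaleA.
  by rewrite (_ : n.+1%:Z = n%:Z + 1) ?wtS // -addn1 PoszD.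
- rewrite -F_wvec scalerA gKF scale_algE -scalerA IH scale_cscale cscaleA.
  congr (cscale _ _); rewrite -[in LHS](subrK 1 (- n%:Z)) wtS mulKf ?expf_neq0 //.
  by rewrite -addn1 PoszD opprD.
Qed.

Lemma weight_KV (v : V) x : x != 0 -> K *: v = cscale x v -> KV *: v = cscale x^-1 v.
Proof.
move=> x0 Kv; have {1}-> : v = cscale x^-1 (K *: v).
  by rewrite Kv cscaleA mulVf // cscale1.
by rewrite scale_cscale scalerA gKVK scale1r.
Qed.

Lemma weight_casimir (v : V) x : x != 0 -> K *: v = cscale x v ->
  casimir q *: v = (E * F) *: v + cscale (casK x) v.
Proof.
move=> x0 Kv; rewrite /casimir scalerDl scale_algE scalerDl !scale_algE Kv.
by rewrite (weight_KV x0 Kv) !cscaleA -cscaleDl cscaleA mulrC.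
Qed.

(** As the Casimir element is central, it acts by the same scalar om on the whole
    chain, and EF is what remains after subtracting its K-part. *)
Lemma EF_wvec n : E *: (F *: wvec n) = cscale (mun n) (wvec n).
Proof.
have Omn : casimir q *: wvec n = cscale om (wvec n).
  by case: n => m /=; rewrite scalerA casimir_central // -scalerA Omv0 scale_cscale.
have := weight_casimir (wt_neq0 n) (K_wvec n).
by rewrite Omn scalerA cscaleBl => ->; rewrite addrK.
Qed.

Lemma FE_wvec n : F *: (E *: wvec n) = cscale (mun (n + 1)) (wvec n).
Proof.
rewrite scalerA gFE scalerBl -scalerA EF_wvec scale_algE scalerBl K_wvec.
rewrite (weight_KV (wt_neq0 n) (K_wvec n)) -cscaleBl cscaleA -cscaleBl.
by rewrite munS.
Qed.

Lemma F_wvecS (n : nat) : F *: wvec n.+1 = cscale (mun n.+1) (wvec n).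
Proof. by rewrite -E_wvec FE_wvec -addn1 PoszD. Qed.

Lemma E_wvecN (n : nat) : E *: wvec (- n.+1%:Z) = cscale (mun (- n%:Z)) (wvec (- n%:Z)).
Proof. by rewrite -F_wvec EF_wvec. Qed.

Hypothesis gen : forall v : V, exists x : U, v = x *: v0.

Lemma wvec_span : cspan wvec = setT.
Proof.
have sub : is_submodule (cspan wvec).
  apply: span_submodule => n; split.
  - case: n => n; first by rewrite E_wvec; apply: cspan_gen.
    by rewrite NegzE E_wvecN; apply/cspan_cscale/cspan_gen.
  - case: n => [[|n]|n]; last by rewrite NegzE F_wvec; apply: cspan_gen.
      by rewrite (F_wvec 0); apply: cspan_gen.
    by rewrite F_wvecS; apply/cspan_cscale/cspan_gen.
  - by rewrite K_wvec; apply/cspan_cscale/cspan_gen.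
  - rewrite (weight_KV (wt_neq0 n) (K_wvec n)).
    by apply/cspan_cscale/cspan_gen.
apply/seteqP; split=> // v _; have [x ->] := gen v; apply: submodZ => //.
by have := cspan_gen wvec 0; rewrite /= expr0 scale1r.
Qed.

End WeightVectors.

(** * A weight module on functions on the integers *)

Section WeightModule.
Variables (R : realType) (q : R).
Hypotheses (q0 : 0 < q) (q1 : q < 1).
Local Notation U := (Uq q).
Local Notation C := R[i].
Local Notation cq := (q%:C).
Variables (lam om : C).
Hypothesis lam0 : lam != 0.
Local Notation wt := (wt q lam).
Local Notation mun := (mun q lam om).

Let cq0 := qC_neq0 q0.

(** On the link between n - 1 and n, E maps the delta function at n - 1 to
    [ecoef n] times that at n, and F goes back with the factor [fcoef n]. Where
    EF has a nonpositive eigenvalue, the coefficients are those for which the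
    delta functions are orthonormal for an invariant inner product; elsewhere
    only their product matters. *)
Definition fcoef (n : int) : C :=
  if mun n <= 0 then sqrtC (- mun n / wt n) else mun n.
Definition ecoef (n : int) : C :=
  if mun n <= 0 then - (wt n * fcoef n) else 1.

Lemma ecoefM n : ecoef n * fcoef n = mun n.
Proof.
rewrite /ecoef /fcoef; case: ifP => le0; last by rewrite mul1r.
set s := sqrtC _; have ss : s * s = - mun n / wt n by rewrite -expr2 sqrtCK.
rewrite le0; have -> : - (wt n * s) * s = - (s * s * wt n) by ring.
by rewrite ss divfK ?opprK // wt_neq0.
Qed.

Lemma fcoef0 n : mun n = 0 -> fcoef n = 0.
Proof. by rewrite /fcoef => ->; rewrite lexx oppr0 mul0r sqrtC0. Qed.

Lemma ecoef0 n : mun n = 0 -> ecoef n = 0.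
Proof. by move=> n0; rewrite /ecoef fcoef0 // n0 lexx mulr0 oppr0. Qed.

Local Notation fct := (int -> C).

(** E and F are the weighted shifts to the right and to the left; on functions
    the shift by one step reads the neighbouring value. *)
Fixpoint wact (t : uterm R) (f : fct) : fct :=
  match t with
  | UC a => fun n => a * f n
  | UE => fun n => ecoef n * f (n - 1)
  | UF => fun n => fcoef (n + 1) * f (n + 1)
  | UK => fun n => wt n * f n
  | UKV => fun n => (wt n)^-1 * f n
  | UAdd x y => fun n => wact x f n + wact y f n
  | UMul x y => wact x (wact y f)
  end.

Lemma wact_linear t a (f g : fct) :
  wact t (fun n => a * f n + g n) = (fun n => a * wact t f n + wact t g n).
Proof.
elim: t a f g => [c|||||x IHx y IHy|x IHx y IHy] a f g /=;
  try by apply/funext => n; ring.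
- by rewrite IHx IHy; apply/funext => n; ring.
- by rewrite IHy IHx.
Qed.

Lemma wactD t (f g : fct) :
  wact t (fun n => f n + g n) = (fun n => wact t f n + wact t g n).
Proof.
have := wact_linear t 1 f g.
under eq_fun do rewrite mul1r.
by move=> ->; apply/funext => n; rewrite mul1r.
Qed.

Lemma wact0 t : wact t (fun=> 0) = (fun=> 0).
Proof.
have := wact_linear t (-1) (fun=> 0) (fun=> 0).
under eq_fun do rewrite mulr0 addr0.
by move=> ->; apply/funext => n; ring.
Qed.

Lemma wactZ t a (f : fct) : wact t (fun n => a * f n) = (fun n => a * wact t f n).
Proof.
have := wact_linear t a f (fun=> 0).
under eq_fun do rewrite addr0.
by move=> ->; apply/funext => n; rewrite wact0 addr0.
Qed.

Lemma wact_cong s t : ucong q s t -> wact s = wact t.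
Proof.
suff main : ucong q s t -> forall f, wact s f = wact t f.
  by move=> st; apply/funext => f; apply: main.
elim=> //=.
- by move=> x y z _ e1 _ e2 f; rewrite e1.
- by move=> x x' y y' _ e1 _ e2 f; rewrite e1 e2.
- by move=> x x' y y' _ e1 _ e2 f; rewrite e1 e2.
- by move=> x y z f; apply/funext => n; rewrite addrA.
- by move=> x y f; apply/funext => n; rewrite addrC.
- by move=> x f; apply/funext => n; ring.
- by move=> x f; apply/funext => n; ring.
- by move=> x f; apply/funext => n; ring.
- by move=> x f; congr (wact x _); apply/funext => n; ring.
- by move=> x y z f; rewrite wactD.
- by move=> a b f; apply/funext => n; ring.
- by move=> a b f; apply/funext => n; ring.
- by move=> a x f; rewrite wactZ.
- by move=> f; apply/funext => n; rewrite mulVKf ?wt_neq0 // mul1r.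
- by move=> f; apply/funext => n; rewrite mulKf ?wt_neq0 // mul1r.
- move=> f; apply/funext => n; rewrite -{1}(subrK 1 n) wtS //; ring.
- move=> f; apply/funext => n; rewrite wtS //.
  by field.
- move=> f; apply/funext => n; rewrite subrK addrK mulN1r !mulrA.
  rewrite ecoefM [fcoef _ * _]mulrC ecoefM -mulrBl.
  by rewrite -(munS q0 q1 om lam0); ring.
Qed.

Definition weight_module (_ : 0 < q) (_ : q < 1) (_ : lam != 0) (_ : C) : Type := fct.
Local Notation W := (weight_module q0 q1 lam0 om).

HB.instance Definition _ := Choice.on W.
Fact wm_addA : associative (fun f g : W => (fun n => f n + g n) : W).
Proof. by move=> f g h; apply/funext => n; rewrite addrA. Qed.
Fact wm_addC : commutative (fun f g : W => (fun n => f n + g n) : W).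
Proof. by move=> f g; apply/funext => n; rewrite addrC. Qed.
Fact wm_add0 : left_id ((fun=> 0) : W) (fun f g : W => (fun n => f n + g n) : W).
Proof. by move=> f; apply/funext => n; rewrite add0r. Qed.
Fact wm_addN : left_inverse ((fun=> 0) : W) (fun f : W => (fun n => - f n) : W)
  (fun f g : W => (fun n => f n + g n) : W).
Proof. by move=> f; apply/funext => n; rewrite addNr. Qed.

HB.instance Definition _ := GRing.isZmodule.Build W
  wm_addA wm_addC wm_add0 wm_addN.

Definition wm_scale (x : U) (f : W) : W := wact (repr x) f.

Lemma wm_scaleE t (f : W) : wm_scale (upi q t) f = wact t f.
Proof. by rewrite /wm_scale (wact_cong (upi_repr q t)). Qed.

Fact wm_scaleA x y f : wm_scale x (wm_scale y f) = wm_scale (x * y) f.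
Proof. by elim/upi_ind: x => x; elim/upi_ind: y => y; rewrite upiM !wm_scaleE. Qed.
Fact wm_scale1 : left_id 1 wm_scale.
Proof. by move=> f; rewrite [LHS]wm_scaleE; apply/funext => n /=; rewrite mul1r. Qed.
Fact wm_scaleDr : right_distributive wm_scale +%R.
Proof. by move=> x f g; exact: wactD. Qed.
Fact wm_scaleDl f : {morph wm_scale^~ f : x y / x + y}.
Proof. by elim/upi_ind=> x; elim/upi_ind=> y; rewrite upiD !wm_scaleE. Qed.

HB.instance Definition _ := GRing.Zmodule_isLmodule.Build U W
  wm_scaleA wm_scale1 wm_scaleDr wm_scaleDl.

Lemma wmD (f g : W) n : (f + g) n = f n + g n. Proof. by []. Qed.

Lemma wmE (f : W) n : (gE q *: f) n = ecoef n * f (n - 1).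
Proof. by rewrite [gE q *: f]wm_scaleE. Qed.

Lemma wmF (f : W) n : (gF q *: f) n = fcoef (n + 1) * f (n + 1).
Proof. by rewrite [gF q *: f]wm_scaleE. Qed.

Lemma wmK (f : W) n : (gK q *: f) n = wt n * f n.
Proof. by rewrite [gK q *: f]wm_scaleE. Qed.

Lemma wmZ a (f : W) n : (cscale a f) n = a * f n.
Proof.
have -> : cscale a f = upi q (UMul (UC a) (UC 1)) *: f by rewrite -upiZ.
by rewrite [X in X n]wm_scaleE /= mul1r.
Qed.

Definition wdelta : W := fun n => (n == 0)%:R.

Lemma wdelta_K : gK q *: wdelta = cscale lam wdelta.
Proof.
apply/funext => n; rewrite wmK wmZ /wdelta.
by have [->|] := eqVneq n 0; rewrite ?mulr0 // wt0.
Qed.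

Lemma wdelta_EF : (gE q * gF q) *: wdelta = cscale (mun 0) wdelta.
Proof.
apply/funext => n; rewrite -scalerA wmE wmF wmZ /wdelta subrK mulrA ecoefM.
by have [->|] := eqVneq n 0; rewrite ?mulr0.
Qed.

(** The delta function spans a lowest, respectively highest, weight space of the
    submodule it generates as soon as the EF-eigenvalue on the link below,
    respectively above, vanishes: both coefficients of this link are then 0. *)
Lemma wdelta_F : mun 0 = 0 -> gF q *: wdelta = 0.
Proof.
move=> m0; apply/funext => n; rewrite wmF /wdelta.
by have [->|] := eqVneq (n + 1) 0; rewrite ?mulr0 // fcoef0 // mul0r.
Qed.

Lemma wdelta_E : mun 1 = 0 -> gE q *: wdelta = 0.
Proof.
move=> m0; apply/funext => n; rewrite wmE /wdelta subr_eq0.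
by have [->|] := eqVneq n 1; rewrite ?mulr0 // ecoef0 // mul0r.
Qed.

Lemma wdelta_neq0 : wdelta != 0.
Proof.
apply/eqP => /(congr1 (fun f : W => f 0)); rewrite /wdelta eqxx /=.
by move/eqP; rewrite oner_eq0.
Qed.

End WeightModule.

(** * Unitary modules generated by a weight vector *)

(** The module V is generated by the weight vector v0. The map iota enumerates
    the positions on the chain of weight spaces that are occupied; they form an
    interval D around 0. On each link between two occupied positions EF is
    negative, which makes the invariant Hermitian form positive. The map Theta
    into functions on the integers supplies coordinates. *)
Section UnitaryChain.
Variables (R : realType) (q : R).
Hypotheses (q0 : 0 < q) (q1 : q < 1).
Local Notation U := (Uq q).
Local Notation C := R[i].
Local Notation E := (gE q).
Local Notation F := (gF q).
Local Notation K := (gK q).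
Local Notation KV := (gKV q).
Variables (lam om : C) (tau : R).
Hypothesis lam_tau : lam = (q `^ tau)%:C.
Hypothesis lam0 : lam != 0.
Local Notation wt := (wt q lam).
Local Notation mun := (mun q lam om).
Local Notation W := (weight_module q0 q1 lam0 om).
Variables (V : lmodType U) (v0 : V).
Hypotheses (Kv0 : K *: v0 = cscale lam v0) (Omv0 : casimir q *: v0 = cscale om v0).
Hypothesis gen : forall v : V, exists x : U, v = x *: v0.
Variable Theta : {linear V -> W}.
Hypothesis Theta_v0 : Theta v0 = wdelta q0 q1 om lam0.
Variables (I : choiceType) (iota : I -> int).
Hypothesis iota_inj : injective iota.
Local Notation D := (range iota).
Local Notation wvec := (wvec v0).
Hypotheses (D0 : D 0) (Dpos : forall n : nat, D n.+1 -> D n)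
  (Dneg : forall n : nat, D (- n.+1%:Z) -> D (- n%:Z)).
Hypothesis wvec_off : forall n, ~ D n -> wvec n = 0.
Hypothesis mun_neg : forall n, D n -> D (n - 1) -> mun n < 0.

Let vec i := wvec (iota i).
Let w i := wt (iota i).

Let w_inj : injective w.
Proof. by move=> i j /(wt_inj q0 q1 lam0) /iota_inj. Qed.

Let K_vec i : K *: vec i = cscale (w i) (vec i).
Proof. exact: K_wvec. Qed.

Lemma wt_powR n : wt n = (q `^ (tau + 2 * n%:~R))%:C.
Proof.
have -> : q `^ (tau + 2 * n%:~R) = q `^ tau * q ^ (n * 2).
  rewrite powRD; last by rewrite (gt_eqF q0) implybT.
  have -> : 2 * n%:~R = (n * 2)%:~R :> R by rewrite intrM mulrC.
  by rewrite powR_intmul // ltW.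
by rewrite rmorphM fmorphXz /wt lam_tau.
Qed.

Lemma wt_gt0 n : 0 < wt n.
Proof. by rewrite wt_powR ltcR powR_gt0. Qed.

Lemma conj_wt n : Num.conj (wt n) = wt n.
Proof. by rewrite geC0_conj // ltW // wt_gt0. Qed.

Lemma vec_span : cspan vec = setT.
Proof.
apply/seteqP; split=> // v _.
have : cspan wvec v by rewrite (wvec_span q0 q1 lam0 Kv0 Omv0 gen).
apply: cspan_sub v; first exact: cspan0.
- by move=> u v; apply: cspanD.
- by move=> a v; apply: cspan_cscale.
move=> n; have [[i _ <-]|nD] := pselect (D n); first exact: (cspan_gen vec i).
by rewrite wvec_off //; apply: cspan0.
Qed.

Lemma v0_neq0 : v0 != 0.
Proof.
apply/eqP => v00; have := wdelta_neq0 q0 q1 om lam0.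
by rewrite -Theta_v0 v00 linear0 eqxx.
Qed.

(** Along the chain, EF and FE act by nonzero scalars, so one can go back from
    any weight vector to the generator. *)
Lemma vec_back i : exists x : U, x *: vec i = v0.
Proof.
have wvec0 : wvec 0 = v0 by rewrite /= expr0 scale1r.
suff main n : (D n%:Z -> exists x : U, x *: wvec n = v0) /\
    (D (- n%:Z) -> exists x : U, x *: wvec (- n%:Z) = v0).
  have Di : D (iota i) by exists i.
  by rewrite /vec; case: (iota i) Di => m; [exact: (main m).1|exact: (main m.+1).2].
elim: n => [|n [IHp IHn]].
  by rewrite oppr0 wvec0; split=> _; exists 1; rewrite scale1r.
split=> DS.
- have Dn := Dpos DS; have [x xv] := IHp Dn.
  have m0 : mun n.+1 < 0 by apply: mun_neg => //; rewrite -addn1 PoszD addrK.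
  exists ((mun n.+1)^-1 *: x * F).
  rewrite -scalerA (F_wvecS q0 q1 lam0 Kv0 Omv0) scale_cscale scale_algE cscaleA.
  by rewrite mulfV ?lt_eqF // cscale1.
- have Dn := Dneg DS; have [x xv] := IHn Dn.
  have m0 : mun (- n%:Z) < 0.
    by apply: mun_neg => //; rewrite -opprD -PoszD addn1.
  exists ((mun (- n%:Z))^-1 *: x * E).
  rewrite -scalerA (E_wvecN q0 q1 lam0 Kv0 Omv0) scale_cscale scale_algE cscaleA.
  by rewrite mulfV ?lt_eqF // cscale1.
Qed.

Lemma vec_neq0 i : vec i != 0.
Proof.
apply/eqP => vi0; have [x] := vec_back i; rewrite vi0 scaler0 => /eqP.
by rewrite eq_sym (negbTE v0_neq0).
Qed.

Let KD (v v' : V) : K *: (v + v') = K *: v + K *: v'.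
Proof. by rewrite scalerDr. Qed.
Let KZ a (v : V) : K *: cscale a v = cscale a (K *: v).
Proof. by rewrite scale_cscale. Qed.
Let Kterm (c : I -> C) i :
  K *: cscale (c i) (vec i) = cscale (w i) (cscale (c i) (vec i)).
Proof. by rewrite scale_cscale K_vec !cscaleA mulrC. Qed.

Let component (s : seq I) (c : I -> C) i : uniq s ->
  \sum_(j <- s | w j == w i) cscale (c j) (vec j) =
  if i \in s then cscale (c i) (vec i) else 0.
Proof.
move=> us; rewrite (eq_bigl (pred1 i)) => [|j]; last by rewrite /= (inj_eq w_inj).
case: ifPn => [si|si]; first by rewrite -big_filter filter_pred1_uniq ?big_seq1.
by rewrite big1_seq // => j /andP[/eqP ->]; rewrite (negbTE si).
Qed.

(** A nonzero submodule contains one of the weight vectors, hence everything. *)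
Lemma chain_irreducible : irreducible V.
Proof.
split=> [|Z HZ]; first by exists v0; exact: v0_neq0.
have [[v [Zv v_neq0]]|Z0] := pselect (exists v, Z v /\ v != 0); last first.
  left; apply/seteqP; split=> [v Zv|v ->]; last exact: submod0.
  by apply: contrapT => /eqP v_neq0; apply: Z0; exists v.
have sv : cspan vec v by rewrite vec_span.
right; have [s [c [us vE]]] := cspan_uniq sv.
have [i si ci] : exists2 i, i \in s & c i != 0.
  apply: contrapT => all0; case/eqP: v_neq0; rewrite vE big1_seq // => i /= si.
  have [->|ci] := eqVneq (c i) 0; first by rewrite cscale0.
  by case: all0; exists i.
have Zi : Z (cscale (c i) (vec i)).
  have := component c i us; rewrite si => <-.
  apply: (spectral_component KD KZ (Kterm c)).
  - by move=> ? ?; apply: submodB.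
  - by move=> ? ?; apply: submodZ.
  - by move=> ?; apply: submodZ.
  - by rewrite -vE.
have [x xi] := vec_back i; have Zv0 : Z v0.
  rewrite -xi -[vec i]cscale1 -(mulVf ci) -cscaleA.
  exact/(submodZ HZ)/(submodZ HZ).
apply/seteqP; split=> // v' _; have [y ->] := gen v'.
exact: submodZ.
Qed.

Lemma Theta_inj : injective Theta.
Proof.
apply: (irreducible_inj (v0 := v0) chain_irreducible).
by rewrite Theta_v0 wdelta_neq0.
Qed.

(** A function of weight [wt n] for K is concentrated at n. *)
Lemma Theta_wvec n m : m != n -> Theta (wvec n) m = 0.
Proof.
move=> mn; have := congr1 (fun f : W => f m) (congr1 Theta (K_wvec q0 Kv0 n)).
rewrite linearZ linear_cscale /= wmK wmZ => /eqP.
rewrite -subr_eq0 -mulrBl mulf_eq0 subr_eq0 => /orP[|/eqP //].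
by move=> /eqP /(wt_inj q0 q1 lam0) /eqP; rewrite (negbTE mn).
Qed.

Lemma Theta_supp v : exists s : seq int, [/\ uniq s, (forall n, n \in s -> D n) &
  forall n, n \notin s -> Theta v n = 0].
Proof.
have : cspan vec v by rewrite vec_span.
move=> /cspan_uniq [s [c [us ->]]]; exists [seq iota i | i <- s].
rewrite map_inj_uniq //; split=> // [n /mapP[i _ ->]|n ns]; first by exists i.
rewrite linear_sum.
have -> : (\sum_(i <- s) Theta (cscale (c i) (vec i)) : W) n =
          \sum_(i <- s) Theta (cscale (c i) (vec i)) n.
  by elim/big_rec2: _ => // i y1 y2 _ <-; rewrite wmD.
rewrite big1_seq // => i /= si; rewrite linear_cscale wmZ Theta_wvec ?mulr0 //.
by apply: contra ns => /eqP ->; apply: map_f.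
Qed.

(** The inner product for which the delta functions are orthonormal, pulled back
    along Theta. All values of Theta have finite support. *)
Definition Theta_ip (u v : V) : C :=
  \sum_(n \in [set: int]) (Theta u n * Num.conj (Theta v n)).

Lemma Theta_ipE u v s : uniq s ->
  (forall n, n \notin s -> Theta u n = 0 \/ Theta v n = 0) ->
  Theta_ip u v = \sum_(n <- s) Theta u n * Num.conj (Theta v n).
Proof.
move=> us s0; rewrite /Theta_ip (fsbigE s) //=; last first.
  by move=> n _ /s0 [] ->; rewrite ?rmorph0 ?mul0r ?mulr0.
by apply: eq_bigl => n; rewrite in_setT.
Qed.

Lemma Theta_ip_inner : inner_product Theta_ip.
Proof.
split.
- move=> a u v x; have [s [us _ s0]] := Theta_supp x.
  rewrite !(Theta_ipE us); try by move=> n /s0; right.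
  rewrite mulr_sumr -big_split /=; apply: eq_bigr => n _.
  by rewrite linearD linear_cscale wmD wmZ mulrDl mulrA.
- move=> u v; have [s [us _ s0]] := Theta_supp u.
  rewrite (Theta_ipE us) => [|n /s0]; last by right.
  rewrite (Theta_ipE us) => [|n /s0]; last by left.
  rewrite rmorph_sum; apply: eq_bigr => n _.
  by rewrite rmorphM /= conjCK mulrC.
- move=> v v_neq0; have [s [us _ s0]] := Theta_supp v.
  rewrite (Theta_ipE us) => [|n /s0]; last by left.
  rewrite lt_def sumr_ge0 => [|n _]; last exact: mul_conjC_ge0.
  rewrite andbT psumr_neq0 => [|n _]; last exact: mul_conjC_ge0.
  apply: contraT => /hasPn all0; case/eqP: v_neq0; apply: Theta_inj.
  rewrite linear0; apply/funext => n.
  have [/all0|/s0 //] := boolP (n \in s).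
  by rewrite /= mul_conjC_gt0 negbK => /eqP.
Qed.

Lemma Theta_off v n : Theta v n != 0 -> D n.
Proof.
have [s [_ sD s0]] := Theta_supp v => vn; apply: sD.
by apply: contraT => /s0 /eqP; rewrite (negbTE vn).
Qed.

Let ipZ a u v : Theta_ip (cscale a u) v = a * Theta_ip u v.
Proof.
have [lin _ _] := Theta_ip_inner; have := lin a u 0 v; rewrite addr0 => ->.
have := lin 1 0 0 v; rewrite cscale1 mul1r addr0 -[LHS]addr0 => /addrI <-.
by rewrite addr0.
Qed.

Let ipD u v x : Theta_ip (u + v) x = Theta_ip u x + Theta_ip v x.
Proof.
by have [lin _ _] := Theta_ip_inner; rewrite -{1}[u]cscale1 lin mul1r.
Qed.

Let ipC u v : Theta_ip v u = Num.conj (Theta_ip u v).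
Proof. by have [_ herm _] := Theta_ip_inner. Qed.

Let ipZr a u v : Theta_ip u (cscale a v) = Num.conj a * Theta_ip u v.
Proof. by rewrite ipC ipZ rmorphM /= -ipC. Qed.

Let ipDr u v x : Theta_ip u (v + x) = Theta_ip u v + Theta_ip u x.
Proof. by rewrite ipC ipD rmorphD /= -!ipC. Qed.

Let ipNr u v : Theta_ip u (- v) = - Theta_ip u v.
Proof.
have -> : - v = cscale (-1) v by rewrite cscaleNl cscale1.
by rewrite ipZr rmorphN rmorph1 mulN1r.
Qed.

Lemma fcoef_real n : mun n < 0 -> Num.conj (fcoef q lam om n) = fcoef q lam om n.
Proof.
move=> m0; rewrite /fcoef (ltW m0) geC0_conj // sqrtC_ge0.
by rewrite divr_ge0 ?oppr_ge0 ?ltW ?wt_gt0.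
Qed.

(** Moving E across the inner product shifts the summation index; the choice of
    the coefficients makes the two sums agree term by term. *)
Let ipE u v : Theta_ip (E *: u) v = Theta_ip u (star E *: v).
Proof.
have starEv : star E *: v = cscale (-1) (F *: (K *: v)).
  by rewrite starE ?gt_eqF // scaleNr -scalerA cscaleNl cscale1.
rewrite /Theta_ip [in RHS](reindex_fsbigT (fun n => n - 1)) /=; last first.
  by exists (fun n => n + 1) => n; rewrite ?subrK ?addrK.
apply: eq_fsbigr => n _; rewrite starEv linear_cscale wmZ !linearZ /=.
rewrite wmE wmF subrK wmK.
have [->|un] := eqVneq (Theta u (n - 1)) 0; first by rewrite mulr0 !mul0r.
have [->|vn] := eqVneq (Theta v n) 0; first by rewrite !mulr0 rmorph0 !mulr0.
have mn : mun n < 0 by apply: mun_neg; [exact: Theta_off vn|exact: Theta_off un].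
rewrite /ecoef (ltW mn); move: (conj_wt n) (fcoef_real mn).
move: (wt n) (fcoef q lam om n) => x y xE yE.
by rewrite !rmorphM /= rmorphN rmorph1 xE yE; ring.
Qed.

Let ipK u v : Theta_ip (K *: u) v = Theta_ip u (K *: v).
Proof.
rewrite /Theta_ip; apply: eq_fsbigr => n _; rewrite !linearZ /= !wmK.
by rewrite rmorphM /= conj_wt; ring.
Qed.

Let ipKV u v : Theta_ip (KV *: u) v = Theta_ip u (KV *: v).
Proof.
have {1}-> : v = K *: (KV *: v) by rewrite scalerA gKKV scale1r.
by rewrite -ipK scalerA gKKV scale1r.
Qed.

(* F is minus the adjoint of E times the inverse of K, so its adjoint follows
   from those of E and of the inverse of K. *)
Let ipF u v : Theta_ip (F *: u) v = Theta_ip u (star F *: v).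
Proof.
have {1}-> : u = K *: (KV *: u) by rewrite scalerA gKKV scale1r.
have -> : F *: (K *: (KV *: u)) = - (star E *: (KV *: u)).
  by rewrite starE ?gt_eqF // scaleNr opprK scalerA.
rewrite [LHS]ipC ipNr -ipE rmorphN /= -ipC ipKV.
by rewrite starF ?gt_eqF // scaleNr ipNr -scalerA.
Qed.

Lemma Theta_ip_star : star_invariant Theta_ip.
Proof.
move=> x; elim/Uq_ind: x => [a|||||x y IHx IHy|x y IHx IHy] u v //.
- rewrite starZ ?gt_eqF // star1 ?gt_eqF // ipZr conjCK; exact: ipZ.
- by rewrite starK ?gt_eqF.
- by rewrite starKV ?gt_eqF.
- by rewrite starD ?gt_eqF // !scalerDl ipD ipDr IHx IHy.
- by rewrite starM ?gt_eqF // -!scalerA IHx IHy.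
Qed.

Let vec_decomp (v : V) : exists (s : seq I) (c : I -> C),
  uniq s /\ v = \sum_(i <- s) cscale (c i) (vec i).
Proof. by apply: cspan_uniq; rewrite vec_span. Qed.

Lemma eigen_vec (v : V) i : K *: v = cscale (w i) v -> exists c, v = cscale c (vec i).
Proof.
move=> Kv; have [s [c [us vE]]] := vec_decomp v.
rewrite (spectral_eigen KD KZ (Kterm c) Kv vE) component //.
by case: ifP => _; [exists (c i)|exists 0; rewrite cscale0].
Qed.

Lemma eigen_off (v : V) a : K *: v = cscale a v -> (forall i, w i != a) -> v = 0.
Proof.
move=> Kv wa; have [s [c [us vE]]] := vec_decomp v.
rewrite (spectral_eigen KD KZ (Kterm c) Kv vE) big1 // => i.
by rewrite (negbTE (wa i)).
Qed.

Lemma chain_admissible : admissible V.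
Proof.
split=> [v|a].
  have : cspan vec v by rewrite vec_span.
  move=> [m [i [c ->]]]; exists m, (fun j => w (i j)).
  exists (fun j => cscale (c j) (vec (i j))); split=> // j.
  exact: (Kterm (fun=> c j)).
have [[i wi]|na] := pselect (exists i, w i = a).
  exists 1%N, (fun=> vec i) => v; rewrite /K_eigenspace /= -wi => /eigen_vec [c ->].
  by apply/cspan_cscale/(cspan_gen (fun=> vec i) (ord0 : 'I_1)).
exists 0%N, (fun=> 0) => v /eigen_off ->; first exact: cspan0.
by move=> i; apply/eqP => wi; apply: na; exists i.
Qed.

Lemma chain_eigenvalues : K_eigenvalues V = [set w i | i in [set: I]].
Proof.
apply/seteqP; split=> [a [v Kv v_neq0]|_ [i _ <-]].
  have [[i wi]|na] := pselect (exists i, w i = a); first by exists i.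
  case/eqP: v_neq0; apply: eigen_off Kv _ => i; apply/eqP => wi.
  by apply: na; exists i.
by exists (vec i); [exact: K_vec|exact: vec_neq0].
Qed.

(** Weight vectors of distinct weights are orthogonal since K is self-adjoint. *)
Lemma vec_orth i j : i != j -> Theta_ip (vec i) (vec j) = 0.
Proof.
move=> ij; have := ipK (vec i) (vec j); rewrite !K_vec ipZ ipZr conj_wt.
move=> /eqP; rewrite -subr_eq0 -mulrBl mulf_eq0 subr_eq0 (inj_eq w_inj).
by rewrite (negbTE ij) => /eqP.
Qed.

(** The orthonormal basis consists of the normalized weight vectors. *)
Theorem chain_series : series_rep I [set w i | i in [set: I]] om V.
Proof.
split.
- exact: chain_irreducible.
- exact: chain_admissible.
- move=> a; rewrite chain_eigenvalues => -[i _ <-].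
  by eexists; exact: wt_powR.
- have [_ _ pos] := Theta_ip_inner.
  pose nrm i := sqrtC (Theta_ip (vec i) (vec i)).
  have nrm_gt0 i : 0 < nrm i by rewrite sqrtC_gt0 pos // vec_neq0.
  exists Theta_ip, (fun i => cscale (nrm i)^-1 (vec i)); split.
  + exact: Theta_ip_inner.
  + exact: Theta_ip_star.
  + move=> i j; rewrite ipZ ipZr; have [<-|ij] := eqVneq i j; last first.
      by rewrite vec_orth // !mulr0.
    have -> : Theta_ip (vec i) (vec i) = nrm i ^+ 2 by rewrite sqrtCK.
    rewrite geC0_conj ?invr_ge0 ?ltW //.
    by rewrite expr2 mulKf ?gt_eqF // mulVf ?gt_eqF.
  + apply/seteqP; split=> // v _; have : cspan vec v by rewrite vec_span.
    apply: cspan_sub v; first exact: cspan0.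
    * by move=> u v; apply: cspanD.
    * by move=> a v; apply: cspan_cscale.
    * move=> i; rewrite -[vec i]cscale1 -(mulfV (lt0r_neq0 (nrm_gt0 i))) -cscaleA .
      exact/cspan_cscale/(cspan_gen (fun i => cscale (nrm i)^-1 (vec i))).
- move=> v; have [x ->] := gen v.
  by rewrite scalerA casimir_central // -scalerA Omv0 scale_cscale.
- exact: chain_eigenvalues.
- by move=> _ [i _ <-]; exists (vec i) => v; exact: eigen_vec.
Qed.

End UnitaryChain.

(** * Equivalence with the series *)

Section Equivalence.
Variables (R : realType) (q : R).
Hypotheses (q0 : 0 < q) (q1 : q < 1).
Local Notation U := (Uq q).
Local Notation C := R[i].
Variables (lam mu om : C) (tau : R).
Hypothesis lam_tau : lam = (q `^ tau)%:C.
Variable chi : U0_char q lam mu.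
Hypothesis omE : mu + casK q lam = om.
Local Notation wt := (wt q lam).
Local Notation mun := (mun q lam om).
Local Notation one := (Mchi1 chi).

Let lam0 : lam != 0 := U0_char_neq0 chi.

Lemma mun0 : mun 0 = mu.
Proof. by rewrite /mun wt0 -omE addrK. Qed.

Lemma Mchi1_casimir : casimir q *: one = cscale om one.
Proof.
rewrite (weight_casimir lam0 (Mchi1_K chi)) Mchi1_EF -cscaleDl.
by rewrite omE.
Qed.

Lemma Mchi_Theta : exists f : {linear Mchi chi -> weight_module q0 q1 lam0 om},
  f one = wdelta q0 q1 om lam0.
Proof.
by apply: Mchi_universal => //; rewrite ?wdelta_K // wdelta_EF mun0.
Qed.

(** The value om of the Casimir element and the weight lam fix the action of EF. *)
Lemma series_vector (I : eqType) (S : set C) (W : lmodType U) :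
  series_rep I S om W -> S lam ->
  exists w0 : W, [/\ w0 != 0, gK q *: w0 = cscale lam w0 &
    (gE q * gF q) *: w0 = cscale mu w0].
Proof.
move=> Wser; rewrite -(series_eigenvalues Wser) => -[w0 Kw0 w0_neq0].
exists w0; split=> //; have := weight_casimir lam0 Kw0.
rewrite (series_casimir Wser) -omE cscaleDl => /eqP.
by rewrite (inj_eq (addIr _)) => /eqP.
Qed.

(** A module of the series contains a vector of weight lam, hence is the image
    of the induced module; Schur's lemma applies if this map factors through an
    irreducible quotient. *)
Lemma Mchi_equivalent (I : eqType) (S : set C) : S lam ->
  series_rep I S om (Mchi chi) ->
  equivalent_to (Mchi chi) (series_rep I S om).
Proof.
move=> Slam ser; split=> [|W Wser]; first by exists (Mchi chi).
have [w0 [w0_neq0 Kw0 EFw0]] := series_vector Wser Slam.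
have [f fE] := Mchi_universal q0 q1 chi Kw0 EFw0.
apply: (Schur (f := f) (v0 := one)); rewrite ?fE //.
  exact: series_irreducible ser.
exact: series_irreducible Wser.
Qed.

(** The map from the induced module to a module of the series factors through the
    quotient when it kills Z. *)
Lemma quotient_equivalent (I : eqType) (S : set C) (Z : set (Mchi chi))
    (HZ : is_submodule Z) : S lam ->
    (forall (W : lmodType U) (f : {linear Mchi chi -> W}), series_rep I S om W ->
      gK q *: f one = cscale lam (f one) -> Z `<=` [set v | f v = 0]) ->
  series_rep I S om (quotmod HZ) ->
  equivalent_to (quotmod HZ) (series_rep I S om).
Proof.
move=> Slam kill ser; split=> [|W Wser]; first by exists (quotmod HZ).
have [w0 [w0_neq0 Kw0 EFw0]] := series_vector Wser Slam.
have [f fE] := Mchi_universal q0 q1 chi Kw0 EFw0.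
have Kone : gK q *: f one = cscale lam (f one) by rewrite fE.
have [g gE] := quotmod_lift HZ (kill W f Wser Kone).
apply: (Schur (f := g) (v0 := quotmod_pi HZ one)); rewrite ?gE ?fE //.
  exact: series_irreducible ser.
exact: series_irreducible Wser.
Qed.

Lemma Mchi_series : (forall n, mun n < 0) ->
  series_rep int [set wt n | n in [set: int]] om (Mchi chi).
Proof.
move=> mun_neg; have [f fE] := Mchi_Theta.
have DT n : range (@id int) n by exists n.
apply: (chain_series lam_tau (Mchi1_K chi) Mchi1_casimir
  (Mchi1_gen (chi := chi)) fE (iota := @id int)) => // n []; exact: DT.
Qed.

Lemma quotient_series (I : choiceType) (iota : I -> int) (Z : set (Mchi chi))
    (HZ : is_submodule Z) : injective iota -> range iota 0 ->
    (forall n : nat, range iota n.+1 -> range iota n) ->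
    (forall n : nat, range iota (- n.+1%:Z) -> range iota (- n%:Z)) ->
    (forall n, ~ range iota n -> Z (wvec one n)) ->
    (forall n, range iota n -> range iota (n - 1) -> mun n < 0) ->
    (forall f : {linear Mchi chi -> weight_module q0 q1 lam0 om},
      f one = wdelta q0 q1 om lam0 -> Z `<=` [set v | f v = 0]) ->
  series_rep I [set wt (iota i) | i in [set: I]] om (quotmod HZ).
Proof.
move=> iota_inj D0 Dpos Dneg Doff mun_neg kill.
have [f fE] := Mchi_Theta; have [g gE] := quotmod_lift HZ (kill f fE).
have [p pE] := linear_of (quotmod_pi_linear HZ).
have Kp : gK q *: p one = cscale lam (p one).
  by rewrite -linearZ Mchi1_K // linear_cscale.
have Omp : casimir q *: p one = cscale om (p one).
  by rewrite -linearZ Mchi1_casimir linear_cscale.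
have p_gen (v : quotmod HZ) : exists x : U, v = x *: p one.
  elim/quotmod_ind: v => v; have [x ->] := Mchi1_gen v.
  by exists x; rewrite -linearZ pE.
have gp : g (p one) = wdelta q0 q1 om lam0 by rewrite pE gE.
apply: (chain_series lam_tau Kp Omp p_gen gp iota_inj) => // n /Doff Zn.
have -> : wvec (p one) n = p (wvec one n).
  by case: n {Zn} => n; rewrite /= linearZ.
by rewrite pE -[RHS](linear0 p) pE; apply/quotmod_piP; rewrite subr0.
Qed.

Lemma kill_span (V V' : lmodType U) (f : {linear V -> V'}) (G : U) (v : V) :
  G *: f v = 0 -> cspan (fun p : nat => G ^+ p.+1 *: v) `<=` [set v | f v = 0].
Proof.
move=> Gfv; apply: cspan_sub => /=.
- exact: linear0.
- by move=> u w fu fw; rewrite linearD fu fw addr0.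
- by move=> a w fw; rewrite linear_cscale fw cscaler0.
- by move=> p; rewrite linearZ /= exprSr -scalerA Gfv scaler0.
Qed.

(** The span of the chain strictly below 0 is stable under E because E annihilates
    [F 1], EF being 0 on the generator. *)
Lemma F_span_submodule : mun 0 = 0 ->
  is_submodule (cspan (fun p : nat => gF q ^+ p.+1 *: one)).
Proof.
move=> mun00; have Kone := Mchi1_K chi; have Omone := Mchi1_casimir.
apply: span_submodule => p.
have span_wvec (n : nat) : cspan (fun p : nat => gF q ^+ p.+1 *: one) (wvec one (Negz n)).
  exact: (cspan_gen (fun p : nat => gF q ^+ p.+1 *: one) n).
rewrite -/(wvec one (Negz p)); split.
- rewrite NegzE (E_wvecN q0 q1 lam0 Kone Omone); case: p => [|p].
    by rewrite oppr0 mun00 cscale0; apply: cspan0.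
  by apply: cspan_cscale; rewrite -NegzE.
- by rewrite NegzE F_wvec -NegzE.
- by rewrite (K_wvec q0 Kone); apply: cspan_cscale.
- rewrite (weight_KV (wt_neq0 q0 lam0 _) (K_wvec q0 Kone _)).
  exact: cspan_cscale.
Qed.

(** Here F annihilates [E 1], as FE is 0 on the generator. *)
Lemma E_span_submodule : mun 1 = 0 ->
  is_submodule (cspan (fun p : nat => gE q ^+ p.+1 *: one)).
Proof.
move=> mun10; have Kone := Mchi1_K chi; have Omone := Mchi1_casimir.
apply: span_submodule => p.
have span_wvec (n : nat) : cspan (fun p : nat => gE q ^+ p.+1 *: one) (wvec one n.+1).
  exact: (cspan_gen (fun p : nat => gE q ^+ p.+1 *: one) n).
rewrite -/(wvec one p.+1); split.
- by rewrite E_wvec.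
- rewrite (F_wvecS q0 q1 lam0 Kone Omone); case: p => [|p].
    by rewrite mun10 cscale0; apply: cspan0.
  exact: cspan_cscale.
- by rewrite (K_wvec q0 Kone); apply: cspan_cscale.
- rewrite (weight_KV (wt_neq0 q0 lam0 _) (K_wvec q0 Kone _)).
  exact: cspan_cscale.
Qed.

(** The image of a weight vector under F, or under E, would be an eigenvector for
    the neighbouring weight. *)
Lemma lowest_weight (W : lmodType U) (w0 : W) :
  gK q *: w0 = cscale lam w0 -> ~ K_eigenvalues W (wt (-1)) -> gF q *: w0 = 0.
Proof.
move=> Kw0 nwt; apply: contrapT => /eqP Fw0; apply: nwt; exists (gF q *: w0) => //.
have := K_wvec q0 Kw0 (-1).
by rewrite /wvec /= expr1.
Qed.

Lemma highest_weight (W : lmodType U) (w0 : W) :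
  gK q *: w0 = cscale lam w0 -> ~ K_eigenvalues W (wt 1) -> gE q *: w0 = 0.
Proof.
move=> Kw0 nwt; apply: contrapT => /eqP Ew0; apply: nwt; exists (gE q *: w0) => //.
have := K_wvec q0 Kw0 1.
by rewrite /wvec /= expr1.
Qed.

Lemma positive_quotient : mun 0 = 0 -> (forall n : nat, mun n.+1 < 0) ->
  exists HZ : is_submodule (cspan (fun p : nat => gF q ^+ p.+1 *: one)),
  equivalent_to (quotmod HZ) (series_rep nat [set wt n%:Z | n in [set: nat]] om).
Proof.
move=> mun00 mun_neg; exists (F_span_submodule mun00).
have range_pos (n : nat) : range Posz n by exists n.
apply: quotient_equivalent.
- by exists 0%N; rewrite // wt0.
- move=> W f Wser Kf; apply: kill_span; apply: lowest_weight => //.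
  by rewrite (series_eigenvalues Wser) => -[n _ /(wt_inj q0 q1 lam0)].
- apply: (quotient_series (iota := Posz)) => //.
  + by move=> m n [].
  + by move=> n [[|m] _].
  + by move=> [n|n] nD; [case: nD | exact: (cspan_gen _ n)].
  + by move=> _ [[|n] _ <-] // [m _].
  + by move=> f fE; apply: kill_span; rewrite fE wdelta_F.
Qed.

Lemma negative_quotient : mun 1 = 0 -> (forall n : nat, mun (- n%:Z) < 0) ->
  exists HZ : is_submodule (cspan (fun p : nat => gE q ^+ p.+1 *: one)),
  equivalent_to (quotmod HZ)
    (series_rep nat [set wt (- n%:Z) | n in [set: nat]] om).
Proof.
move=> mun10 mun_neg; exists (E_span_submodule mun10).
have range_neg (n : nat) : range (fun n : nat => - n%:Z) (- n%:Z) by exists n.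
apply: quotient_equivalent.
- by exists 0%N; rewrite // oppr0 wt0.
- move=> W f Wser Kf; apply: kill_span; apply: highest_weight => //.
  rewrite (series_eigenvalues Wser) => -[n _ /(wt_inj q0 q1 lam0)].
  by case: n.
- apply: (quotient_series (iota := fun n : nat => - n%:Z)) => //.
  + by move=> m n /oppr_inj [].
  + by exists 0%N; rewrite ?oppr0.
  + by move=> n [[|m] _].
  + move=> [[|n]|n] nD; [|exact: (cspan_gen (fun p : nat => gE q ^+ p.+1 *: one) n)|].
      by case: nD; exists 0%N; rewrite ?oppr0.
    by case: nD; exists n.+1.
  + by move=> _ [n _ <-] _.
  + by move=> f fE; apply: kill_span; rewrite fE wdelta_E.
Qed.

End Equivalence.

(** * Signs of the eigenvalues of EF *)

Section Signs.
Variables (R : realType) (q : R).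
Hypotheses (q0 : 0 < q) (q1 : q < 1).
Local Notation C := R[i].
Local Notation cq := (q%:C).

(** Twice the hyperbolic cosine of [x * ln q]. *)
Definition qcosh (x : R) : R := q `^ x + q `^ (- x).

Lemma qcoshN x : qcosh (- x) = qcosh x.
Proof. by rewrite /qcosh opprK addrC. Qed.

Lemma qcosh0 : qcosh 0 = 2.
Proof. by rewrite /qcosh oppr0 powRr0. Qed.

Lemma qcosh_gt0 x : 0 < qcosh x.
Proof. by rewrite addr_gt0 // powR_gt0. Qed.

Lemma qcosh_abs x : qcosh `|x| = qcosh x.
Proof. by have [x0|x0] := ger0P x; rewrite ?qcoshN. Qed.

(** With [u = q^|x|] and [v = q^|y|], where [v < u <= 1], the difference of the
    two sides is [(u - v) (1 - u v) / (u v)]. *)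
Lemma qcosh_lt x y : `|x| < `|y| -> qcosh x < qcosh y.
Proof.
rewrite -[qcosh x]qcosh_abs -[qcosh y]qcosh_abs.
move: (normr_ge0 x); move: `|x| `|y| => {x y} x y x0 xy.
have pow_lt : q `^ y < q `^ x.
  by rewrite /powR (gt_eqF q0) ltr_expR ltr_nM2r // ln_lt0 // q0.
have y_gt0 := powR_gt0 y q0; have x_gt0 := powR_gt0 x q0.
have x_le1 : q `^ x <= 1.
  by rewrite -(powRr0 q); apply: ger_powR; rewrite // q0 ltW.
rewrite /qcosh !powRN -subr_gt0.
have -> : q `^ y + (q `^ y)^-1 - (q `^ x + (q `^ x)^-1) =
    (q `^ x - q `^ y) * (1 - q `^ x * q `^ y) / (q `^ x * q `^ y).
  by field; rewrite !gt_eqF.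
rewrite divr_gt0 ?mulr_gt0 ?subr_gt0 //.
by apply: le_lt_trans (_ : q `^ y < 1); [rewrite ler_piMl // ltW | exact: lt_le_trans x_le1].
Qed.

Lemma qcosh_ge2 x : 2 <= qcosh x.
Proof.
have [->|x0] := eqVneq x 0; first by rewrite qcosh0.
by rewrite ltW // -qcosh0 qcosh_lt // normr0 normr_gt0.
Qed.

Lemma casK_powR t : casK q (q `^ t)%:C = (qcosh (t - 1) / (q - q^-1) ^+ 2)%:C.
Proof.
have eq1 : q `^ (t - 1) = q^-1 * q `^ t.
  by rewrite mulrC powRB ?(gt_eqF q0) ?implybT // powRr1 // ltW.
have eq2 : q `^ (- (t - 1)) = q * (q `^ t)^-1 by rewrite powRN eq1 invfM invrK.
rewrite /casK /qcosh eq1 eq2 -!fmorphV -!rmorphM -rmorphD -rmorphB -rmorphXn.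
by rewrite -fmorphV -rmorphM.
Qed.

Lemma mun_powR L t n : let om := (L / (q - q^-1) ^+ 2)%:C in
  mun q (q `^ t)%:C om n =
  ((L - qcosh (t + 2 * n%:~R - 1)) / (q - q^-1) ^+ 2)%:C.
Proof.
move=> om; rewrite /mun (wt_powR q0 (erefl _)) casK_powR -rmorphB.
by rewrite -mulrBl.
Qed.

Lemma mun_powR_lt0 L t n : let om := (L / (q - q^-1) ^+ 2)%:C in
  L < qcosh (t + 2 * n%:~R - 1) -> mun q (q `^ t)%:C om n < 0.
Proof.
move=> om Llt; rewrite mun_powR ltcR pmulr_llt0 ?subr_lt0 // invr_gt0.
rewrite exprn_even_gt0 //= subr_eq0; apply/negP => /eqP qE.
have : q * q = 1 by rewrite {2}qE mulfV // gt_eqF.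
by apply/eqP; rewrite lt_eqF // mulr_ilt1 // ltW.
Qed.

(** The imaginary part of the Casimir value vanishes on all the series: either
    the real exponent or the sine of the phase is zero. *)
Lemma casimir_valueE a b : 2 * a + 1 = 0 \/ sin (2 * b * ln q) = 0 ->
  casimir_value q (Complex a b) =
  (qcosh (2 * a + 1) * cos (2 * b * ln q) / (q - q^-1) ^+ 2)%:C.
Proof.
move=> real; rewrite /casimir_value.
have -> : 2 * Complex a b + 1 = Complex (2 * a + 1) (2 * b).
  by apply/eqP; rewrite eq_complex /=; apply/andP; split; apply/eqP; ring.
have -> : - 2 * Complex a b - 1 = Complex (- (2 * a + 1)) (- (2 * b)).
  by apply/eqP; rewrite eq_complex /=; apply/andP; split; apply/eqP; ring.
have -> : (cq^-1 - cq) ^+ 2 = ((q - q^-1) ^+ 2)%:C.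
  by rewrite -fmorphV -rmorphB -rmorphXn -opprB sqrrN.
rewrite [in RHS]rmorphM fmorphV /=; congr (_ / _).
rewrite /cpow /= !mulNr cosN sinN /qcosh /powR (gt_eqF q0) mulNr.
apply/eqP; rewrite eq_complex /=; apply/andP; split; apply/eqP; first by ring.
case: real => [->|->]; last by ring.
by rewrite mul0r oppr0; ring.
Qed.

Lemma intr_norm_ge1 (m : int) : m != 0 -> 1 <= `|m%:~R| :> R.
Proof. by move=> m0; rewrite -intr_norm (ler_int _ 1) -gtz0_ge1 normr_gt0. Qed.

(** The Casimir value corresponds to [2 cos t], [- qcosh x] or [qcosh x] with
    [|x| < 1] on the three series. For eps = 0 the exponent of K is an odd
    integer after the shift by 1, so that its qcosh exceeds 2 and all qcosh x with
    [|x| < 1]. For eps = 1/2 it is even and qcosh is only at least 2; then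
    [2 cos t < 2] as the excluded parameter is the one with t = 0. *)
Lemma series_sign (sigma : C) (eps : R) :
  [\/ principal_parameters q sigma eps, strange_parameters q sigma eps
    | complementary_parameters sigma eps] ->
  exists L : R, casimir_value q sigma = (L / (q - q^-1) ^+ 2)%:C /\
    forall m : int, L < qcosh (2 * eps + 2 * m%:~R - 1).
Proof.
have lnq : ln q < 0 by rewrite ln_lt0 // q0.
have odd_ge1 (m : int) : 1 <= `|2 * 0 + 2 * m%:~R - 1| :> R.
  have -> : 2 * 0 + 2 * m%:~R - 1 = (2 * m - 1)%:~R :> R.
    by rewrite mulr0 add0r intrB intrM.
  by apply: intr_norm_ge1; lia.
have gt2_odd (m : int) : 2 < qcosh (2 * 0 + 2 * m%:~R - 1).
  by rewrite -[ltLHS]qcosh0 qcosh_lt // normr0 (lt_le_trans _ (odd_ge1 m)).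
case=> [[[b [/andP[b0 ble] ->]] eps01 neq]|[[a [a0 ->]] eps01]|[[s [/andP[s0 s1] ->]] ->]].
- have x0 : 2 * - 2^-1 + 1 = 0 :> R by field.
  exists (2 * cos (2 * b * ln q)); rewrite casimir_valueE; last by left.
  rewrite x0 qcosh0; split=> // m.
  have cos_le : 2 * cos (2 * b * ln q) <= 2 by rewrite ler_piMr // cos_le1.
  case: eps01 neq => -> neq; first exact: le_lt_trans (gt2_odd m).
  have [b_eq0|b_neq0] := eqVneq b 0; first by case: neq; rewrite b_eq0.
  apply: lt_le_trans (qcosh_ge2 _); rewrite gtr_pMr // -[ltRHS]cos0 -cosN.
  have b_gt0 : 0 < b by rewrite lt_def b_neq0.
  have bpi : - (2 * b * ln q) <= pi.
    have -> : pi = - (pi / (2 * ln q)) * (- (2 * ln q)) :> R.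
      by field; rewrite lt_eqF.
    have -> : - (2 * b * ln q) = b * - (2 * ln q) by ring.
    by rewrite ler_wpM2r //; lra.
  have b2_gt0 : 0 < - (2 * b * ln q) by rewrite oppr_gt0 nmulr_llt0 // mulr_gt0.
  by rewrite ltr_cos ?in_itv /= ?lexx ?pi_ge0 ?bpi ?ltW.
- have phase : 2 * - (pi / (2 * ln q)) * ln q = - pi :> R.
    by field; rewrite lt_eqF.
  exists (qcosh (2 * (- 2^-1 + a) + 1) * - 1); rewrite casimir_valueE; last first.
    by right; rewrite phase sinN sinpi oppr0.
  rewrite phase cosN cospi; split=> // m.
  by rewrite mulrN1; apply: lt_trans (qcosh_gt0 _); rewrite oppr_lt0 qcosh_gt0.
- have phase : 2 * 0 * ln q = 0 by rewrite mulr0 mul0r.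
  exists (qcosh (2 * s + 1)); rewrite (@casimir_valueE s 0); last first.
    by right; rewrite phase sin0.
  rewrite phase cos0 mulr1; split=> // m; apply: qcosh_lt.
  apply: lt_le_trans _ (odd_ge1 m); rewrite ger0_norm; lra.
Qed.

End Signs.

(** * The modules of the three parts *)

Section Series.
Variables (R : realType) (q : R).
Hypotheses (q0 : 0 < q) (q1 : q < 1).
Local Notation C := R[i].

(** The lattice does not depend on which of its points is the base point. *)
Lemma wt_lattice (eps : R) (m0 : int) :
  [set wt q (q `^ (2 * eps + 2 * m0%:~R))%:C n | n in [set: int]] =
  q_lattice q eps.
Proof.
have wtE n : wt q (q `^ (2 * eps + 2 * m0%:~R))%:C n =
    (q `^ (2 * eps + 2 * (m0 + n)%:~R))%:C.
  by rewrite (wt_powR q0 (erefl _)) intrD mulrDr addrA.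
apply/seteqP; split=> [_ [n _ <-]|_ [m _ <-]].
  by exists (m0 + n); rewrite // wtE.
by exists (m - m0); rewrite // wtE [m0 + _]addrC subrK.
Qed.

Lemma lattice_Mchi (sigma : C) (eps : R) (lam mu : C) (chi : U0_char q lam mu) :
  [\/ principal_parameters q sigma eps, strange_parameters q sigma eps
    | complementary_parameters sigma eps] ->
  q_lattice q eps lam -> mu + casK q lam = casimir_value q sigma ->
  lattice_series sigma eps (Mchi chi).
Proof.
move=> params [m0 _ lamE] omE; have [L [casE Llt]] := series_sign q0 q1 params.
rewrite /lattice_series -(wt_lattice eps m0) lamE.
apply: (Mchi_series q0 q1 (esym lamE) chi omE) => n; rewrite -lamE casE.
by apply: mun_powR_lt0 => //; have := Llt (m0 + n); rewrite intrD mulrDr addrA.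
Qed.

Lemma discrete_casimir (k : R) :
  casimir_value q (- k)%:C = (qcosh q (2 * k - 1) / (q - q^-1) ^+ 2)%:C.
Proof.
rewrite (casimir_valueE q0 (a := - k) (b := 0)); last first.
  by right; rewrite mulr0 mul0r sin0.
by rewrite mulr0 mul0r cos0 mulr1 -qcoshN; congr ((qcosh q _ / _)%:C); ring.
Qed.

End Series.

(** * The theorem *)

Unset Implicit Arguments.

Theorem mainTheorem2 (R : realType) (q : R) (q01 : 0 < q < 1) :
  [/\ (* (a) *)
    forall (sigma : R[i]) (eps : R),
      [\/ principal_parameters q sigma eps,
          strange_parameters q sigma eps
        | complementary_parameters sigma eps] ->
      let admits (lam mu : R[i]) :=
        q_lattice q eps lam /\
        mu + (q%:C^-1 * lam + q%:C * lam^-1) / (q%:C - q%:C^-1) ^+ 2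
          = casimir_value q sigma in
      (forall (lam mu : R[i]) (chi : U0_char q lam mu), admits lam mu ->
        [/\ irreducible (Mchi chi), unitarizable (Mchi chi)
          & equivalent_to (Mchi chi) (lattice_series sigma eps)]) /\
      (forall (lam mu lam' mu' : R[i])
          (chi : U0_char q lam mu) (chi' : U0_char q lam' mu'),
        admits lam mu -> admits lam' mu' ->
        isomorphic (Mchi chi) (Mchi chi')),
    (* (b) *)
    forall n : nat, (0 < n)%N -> let k : R := n%:R / 2 in
      let lam := (q `^ (2 * k))%:C in
      forall chi : U0_char q lam 0,
      exists HW : is_submodule
          (cspan (fun p : nat => gF q ^+ p.+1 *: Mchi1 chi)),
        equivalent_to (quotmod HW) (@positive_discrete R q k)
  & (* (c) *)
    forall n : nat, (0 < n)%N -> let k : R := n%:R / 2 in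
      let lam := (q `^ (- 2 * k))%:C in
      forall chi : U0_char q lam ((lam - lam^-1) / (q%:C - q%:C^-1)),
      exists HW : is_submodule
          (cspan (fun p : nat => gE q ^+ p.+1 *: Mchi1 chi)),
        equivalent_to (quotmod HW) (@negative_discrete R q k)].
Proof.
have /andP[q0 q1] := q01; split.
- move=> sigma eps params admits; split=> [lam mu chi|lam mu lam' mu' chi chi'].
    move=> [lam_lat omE]; have ser := lattice_Mchi q0 q1 chi params lam_lat omE.
    split; first exact: series_irreducible ser.
      have [ip [e [inner star _ _]]] := series_unitary ser.
      by exists ip.
    exact: (Mchi_equivalent q0 q1 omE).
  move=> [lam_lat omE] [lam'_lat omE'].
  have ser := lattice_Mchi q0 q1 chi params lam_lat omE.
  have ser' := lattice_Mchi q0 q1 chi' params lam'_lat omE'.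
  exact: (Mchi_equivalent q0 q1 omE _ ser).2.
- move=> n n_gt0 k lam chi.
  have k_ge : 1 <= 2 * k by rewrite /k mulrC divfK // ler1n.
  have casE := discrete_casimir q0 k.
  have munE m : mun q lam (casimir_value q (- k)%:C) m =
      ((qcosh q (2 * k - 1) - qcosh q (2 * k + 2 * m%:~R - 1)) /
        (q - q^-1) ^+ 2)%:C.
    by rewrite casE mun_powR.
  have mun00 : mun q lam (casimir_value q (- k)%:C) 0 = 0.
    by rewrite munE mulr0 addr0 subrr mul0r.
  have omE : 0 + casK q lam = casimir_value q (- k)%:C.
    by move/eqP: mun00; rewrite /mun wt0 subr_eq0 add0r => /eqP.
  have [m|HZ eqv] := positive_quotient q0 q1 (erefl lam) chi omE mun00.
    rewrite casE; apply: mun_powR_lt0 => //; apply: qcosh_lt => //.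
    have m0 : 0 <= m%:R :> R by [].
    by rewrite !ger0_norm -?pmulrn; lra.
  exists HZ; rewrite /positive_discrete.
  suff <- : [set wt q lam m%:Z | m in [set: nat]] =
      [set (q `^ (2 * k + 2 * m%:R))%:C | m in [set: nat]] by [].
  by congr image; apply/funext => m; rewrite (wt_powR q0 (erefl _)).
- move=> n n_gt0 k lam chi.
  have k_ge : 1 <= 2 * k by rewrite /k mulrC divfK // ler1n.
  have casE := discrete_casimir q0 k.
  have munE m : mun q lam (casimir_value q (- k)%:C) m =
      ((qcosh q (2 * k - 1) - qcosh q (- 2 * k + 2 * m%:~R - 1)) /
        (q - q^-1) ^+ 2)%:C.
    by rewrite casE mun_powR.
  have mun10 : mun q lam (casimir_value q (- k)%:C) 1 = 0.
    rewrite munE -(qcoshN q (- 2 * k + 2 * 1 - 1)).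
    have -> : - (- 2 * k + 2 * 1 - 1) = 2 * k - 1 by ring.
    by rewrite subrr mul0r.
  have lam_neq0 : lam != 0 := U0_char_neq0 chi.
  (* EF vanishes on weight q^2 lambda, and mu is its eigenvalue one step
     below. *)
  have omE : (lam - lam^-1) / (q%:C - q%:C^-1) + casK q lam =
      casimir_value q (- k)%:C.
    have := munS q0 q1 (casimir_value q (- k)%:C) lam_neq0 0.
    rewrite add0r mun10 wt0 /mun wt0 => /eqP; rewrite subr_eq0 => /eqP e.
    by rewrite mulrC -e subrK.
  have [m|HZ eqv] := negative_quotient q0 q1 (erefl lam) chi omE mun10.
    rewrite casE; apply: mun_powR_lt0 => //; apply: qcosh_lt => //.
    have m0 : 0 <= m%:R :> R by [].
    rewrite rmorphN /= -pmulrn ger0_norm ?ler0_norm; lra.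
  exists HZ; rewrite /negative_discrete.
  suff <- : [set wt q lam (- m%:Z) | m in [set: nat]] =
      [set (q `^ (- 2 * k - 2 * m%:R))%:C | m in [set: nat]] by [].
  congr image; apply/funext => m; rewrite (wt_powR q0 (erefl _)).
  by rewrite rmorphN /= -pmulrn mulrN.
Qed.
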